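(* Let $G$ be an $A$-generated group, equipped with a rational structure $(G,L)$, in which $L$-representatives are computable and Stallings-like graphs are computable for $L$-quasi-convex subgroups. There are partial algorithms which solve the generalized membership problem, the containment problem, the equality problem and the least constant of $L$-quasi-convexity problem for $L$-quasi-convex subgroups of $G$. If the rational structure $(G,L)$ is induced by an automatic structure, then these algorithms are uniform in the automatic structure.
   Context: Let $A$ be a finite alphabet with at least two letters, $\tilde A = A\cup A^{-1}$, $\tilde A^*$ the free monoid on $\tilde A$, and $F(A)\subset \tilde A^*$ the set of reduced words. $G$ is a group with an epimorphism $\mu\colon\tilde A^*\to G$ respecting inverses. Reduced words $h_1,\dots,h_s$ ''generate the subgroup $H$ of $G$'' if $H=\langle \mu(h_1),\dots,\mu(h_s)\rangle$. Rational structure $(G,L)$: $L\subseteq\tilde A^*$ is a language accepted by a finite automaton, consisting of reduced words, with $\mu(L)=G$. An $L$-representative of $g\in G$ is an element of $L\cap\mu^{-1}(g)$. $L$-representatives are computable if there is an algorithm which, given $u\in F(A)$, computes an $L$-representative of $\mu(u)$. Automatic structure: a finite automaton accepting a language $L$ of reduced words with $\mu(L)=G$ and, for each $a\in\tilde A\cup\{1\}$, a finite automaton accepting (with padding of the shorter word at its right end by a new symbol) the set of pairs $(u,v)\in L\times L$ with $\mu(ua)=\mu(v)$. It induces the rational structure $(G,L)$. $L$-quasi-convexity: $H\le G$ is $L$-quasi-convex with constant $k$ if for every $w\in L\cap\mu^{-1}(H)$, the path in the Cayley graph of $G$ (with respect to $A$) starting at $1$ and labeled $w$ stays within distance at most $k$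 of $H$; $H$ is $L$-quasi-convex if such an integer $k$ exists. Stallings-like graphs: an $A$-graph is a directed graph with edges labeled by letters of $A$; $a^{-1}$ is read by traversing an $a$-edge backwards. A reduced rooted graph $(\Gamma,v)$ is a connected $A$-graph with base vertex $v$ that is folded (distinct edges with the same initial vertex, or the same terminal vertex, have distinct labels) and in which every vertex except perhaps $v$ is incident to at least two edges. $(\Gamma,v)$ is Stallings-like for $H$ with respect to $L$ if every loop at $v$ is labeled by a word in $\mu^{-1}(H)$ and every $L$-representative of an element of $H$ labels a loop at $v$. Stallings-like graphs are computable for $L$-quasi-convex subgroups if there is a partial algorithm which, given finitely many reduced words generating a subgroup $H$, stops and computes a (finite) Stallings-like graph for $H$ with respect to $L$ if $H$ is $L$-quasi-convex, and never stops otherwise. Problems. Generalized membership: given reduced words $h_1,\dots,h_s,h$, decide whether $\mu(h)$ belongs to the subgroup of $G$ generated by $h_1,\dots,h_s$. Containment (resp. equality): given finite tuples of reduced words generating subgroups $H$ and $K$, decide whether $H\le K$ (resp. $H=K$). Least constant of $L$-quasi-convexity: given a finite tuple of reduced words generating $H$, compute the least constant of $L$-quasi-convexity of $H$. A partial algorithm solves a problem for $L$-quasi-convex subgroups if it terminates, with the correct answer, exactly when the subgroups determined by the input are $L$-quasi-convex, and runs forever otherwise. It is uniform in the automatic structure if there is a single partial algorithm which takes as input both an automatic structure inducing $(G,L)$ and the input of the problem, and solves it. *)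

(* Defs.v *)
From HB Require Import structures.
From mathcomp Require Import all_boot.

Set Implicit Arguments.
Unset Strict Implicit.
Unset Printing Implicit Defensive.

Local Open Scope group_scope.

(* The model of computation is Jones' WHILE language over binary trees, in
   combinator form. It is Turing complete. *)

Inductive data : Type :=
| Nil : data
| Cons : data -> data -> data.

Inductive program : Type :=
| PId : program
| PNil : program
| PHead : program
| PTail : program
| PCons : program -> program -> program
| PSeq : program -> program -> program
| PIf : program -> program -> program -> program
| PWhile : program -> program -> program.

(* [eval p x y]: on input [x], the program [p] stops with output [y]. A tree
   counts as true when it is not [Nil]; [PWhile c p] iterates [p] on the store
   as long as [c] evaluates to true on it. *)
Inductive eval : program -> data -> data -> Prop :=
| EvId x : eval PId x x
| EvNil x : eval PNil x Nil
| EvHead a b : eval PHead (Cons a b) a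
| EvHeadNil : eval PHead Nil Nil
| EvTail a b : eval PTail (Cons a b) b
| EvTailNil : eval PTail Nil Nil
| EvCons p q x a b : eval p x a -> eval q x b -> eval (PCons p q) x (Cons a b)
| EvSeq p q x y z : eval p x y -> eval q y z -> eval (PSeq p q) x z
| EvIfTrue c p q x a b y :
    eval c x (Cons a b) -> eval p x y -> eval (PIf c p q) x y
| EvIfFalse c p q x y : eval c x Nil -> eval q x y -> eval (PIf c p q) x y
| EvWhileStop c p x : eval c x Nil -> eval (PWhile c p) x x
| EvWhileStep c p x a b y z :
    eval c x (Cons a b) -> eval p x y -> eval (PWhile c p) y z ->
    eval (PWhile c p) x z.

Definition stops (p : program) (x : data) : Prop := exists y, eval p x y.

Definition code_nat (n : nat) : data := iter n (Cons Nil) Nil.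

Definition code_bool (b : bool) : data := if b then Cons Nil Nil else Nil.

Definition code_option (X : Type) (code : X -> data) (o : option X) : data :=
  if o is Some x then Cons Nil (code x) else Nil.

Definition code_pair (X Y : Type) (cX : X -> data) (cY : Y -> data)
  (z : X * Y) : data := Cons (cX z.1) (cY z.2).

Definition code_seq (X : Type) (code : X -> data) (s : seq X) : data :=
  foldr (fun x t => Cons (code x) t) Nil s.

(* [valid] delimits the inputs about which the problem is posed; [domain] tells
   on which of them a partial algorithm has to stop. *)
Record problem : Type := Problem {
  instance : Type;
  output : Type;
  code_instance : instance -> data;
  code_output : output -> data;
  valid : instance -> Prop;
  domain : instance -> Prop;
  answer : instance -> output -> Prop }.

Definition solves (p : program) (P : problem) : Prop :=
  forall i : instance P, valid i ->
    (domain i -> exists o : output P,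
       answer i o /\ eval p (code_instance i) (code_output o)) /\
    (~ domain i -> ~ stops p (code_instance i)).

Definition solvable (P : problem) : Prop := exists p, solves p P.

(* The problem [P], with the fixed datum [c] supplied as an additional input. *)
Definition with_input (c : data) (P : problem) : problem :=
  {| instance := instance P; output := output P;
     code_instance := fun i => Cons c (code_instance i);
     code_output := @code_output P;
     valid := @valid P; domain := @domain P; answer := @answer P |}.

(* [(a, false)] is the letter a and [(a, true)] its formal inverse. *)
Definition letter (A : finType) : finType := (A * bool)%type.

Definition word (A : finType) : Type := seq (letter A).

Definition linv (A : finType) (x : letter A) : letter A := (x.1, ~~ x.2).

Definition reduced (A : finType) (w : word A) : bool :=
  sorted (fun x y => y != linv x) w.

(* Programs see a letter through its rank in the enumeration of A, so that the
   same program can be run over different alphabets. *)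
Definition code_gen (A : finType) (a : A) : data :=
  code_nat (nat_of_ord (enum_rank a)).

Definition code_letter (A : finType) : letter A -> data :=
  code_pair (@code_gen A) code_bool.

Definition code_word (A : finType) : word A -> data :=
  code_seq (@code_letter A).

Definition code_words (A : finType) : seq (word A) -> data :=
  code_seq (@code_word A).

Record automaton (X : Type) : Type := Automaton {
  initial : seq nat;
  final : seq nat;
  transitions : seq (nat * X * nat) }.

Fixpoint run (X : eqType) (T : seq (nat * X * nat)) (p : nat) (w : seq X)
  (q : nat) : Prop :=
  if w is x :: w' then exists2 r, (p, x, r) \in T & run T r w' q else p = q.

Definition accepts (X : eqType) (M : automaton X) (w : seq X) : Prop :=
  exists p q, [/\ p \in initial M, q \in final M & run (transitions M) p w q].

Definition code_automaton (X : Type) (code : X -> data) (M : automaton X)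
  : data :=
  Cons (code_seq code_nat (initial M))
    (Cons (code_seq code_nat (final M))
       (code_seq (code_pair (code_pair code_nat code) code_nat)
          (transitions M))).

(* A pair of words is read synchronously, the shorter one being padded at its
   right end by [None]. *)
Definition padded_letter (A : finType) : finType :=
  (option (letter A) * option (letter A))%type.

Definition pad (A : finType) (n : nat) (w : word A) : seq (option (letter A)) :=
  map Some w ++ nseq (n - size w) None.

Definition padded_pair (A : finType) (u v : word A) : seq (padded_letter A) :=
  zip (pad (maxn (size u) (size v)) u) (pad (maxn (size u) (size v)) v).

Definition respecting_epimorphism (A : finType) (G : groupType)
  (mu : word A -> G) : Prop :=
  [/\ mu [::] = 1,
      forall u v, mu (u ++ v) = mu u * mu v,
      forall x, mu [:: linv x] = (mu [:: x])^-1
    & forall g, exists w, mu w = g].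

Definition is_subgroup (G : groupType) (H : G -> Prop) : Prop :=
  [/\ H 1,
      forall x y, H x -> H y -> H (x * y)
    & forall x, H x -> H x^-1].

Definition generated (A : finType) (G : groupType) (mu : word A -> G)
  (hs : seq (word A)) (g : G) : Prop :=
  forall H : G -> Prop, is_subgroup H ->
    (forall h, h \in hs -> H (mu h)) -> H g.

Definition rational_structure (A : finType) (G : groupType) (mu : word A -> G)
  (L : word A -> Prop) : Prop :=
  [/\ exists M : automaton (letter A), forall w, L w <-> accepts M w,
      forall w, L w -> reduced w
    & forall g, exists2 w, L w & mu w = g].

(* The multiplier automata are indexed by A together with its inverses and 1,
   the latter being [None]. *)
Record automata (A : finType) : Type := Automata {
  word_automaton : automaton (letter A);
  multiplier : option (letter A) -> automaton (padded_letter A) }.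

Definition automatic_structure (A : finType) (G : groupType)
  (mu : word A -> G) (L : word A -> Prop) (S : automata A) : Prop :=
  [/\ forall w, L w <-> accepts (word_automaton S) w,
      forall w, L w -> reduced w,
      forall g, exists2 w, L w & mu w = g
    & forall (a : option (letter A)) (z : seq (padded_letter A)),
        accepts (multiplier S a) z <->
        exists u v, [/\ L u, L v, mu (u ++ seq_of_opt a) = mu v
                      & z = padded_pair u v]].

Definition code_automata (A : finType) (S : automata A) : data :=
  Cons (code_automaton (@code_letter A) (word_automaton S))
    (code_seq
       (fun a => Cons (code_option (@code_letter A) a)
          (code_automaton (code_pair (code_option (@code_letter A))
                             (code_option (@code_letter A)))
             (multiplier S a)))
       (enum {: option (letter A)})).

Definition representatives_computable (A : finType) (G : groupType)
  (mu : word A -> G) (L : word A -> Prop) : Prop :=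
  exists p, forall u : word A, reduced u ->
    exists w : word A, [/\ L w, mu w = mu u & eval p (code_word u) (code_word w)].

(* [g] and [h] are at distance at most [k] in the Cayley graph. *)
Definition within (A : finType) (G : groupType) (mu : word A -> G) (k : nat)
  (g h : G) : Prop :=
  exists z : word A, size z <= k /\ g * mu z = h.

(* The vertices on the path from 1 labeled w are the images of the prefixes
   of w. *)
Definition quasi_convex_with (A : finType) (G : groupType) (mu : word A -> G)
  (L : word A -> Prop) (H : G -> Prop) (k : nat) : Prop :=
  forall w, L w -> H (mu w) ->
    forall u v, w = u ++ v -> exists2 h, H h & within mu k (mu u) h.

Definition quasi_convex (A : finType) (G : groupType) (mu : word A -> G)
  (L : word A -> Prop) (H : G -> Prop) : Prop :=
  exists k, quasi_convex_with mu L H k.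

(* Both [vertices] and [edges] are read as sets; the edge [(p, a, q)] goes
   from p to q and has label a. *)
Record rooted_graph (A : finType) : Type := RootedGraph {
  base : nat;
  vertices : seq nat;
  edges : seq (nat * A * nat) }.

Definition code_rooted_graph (A : finType) (Gamma : rooted_graph A) : data :=
  Cons (code_nat (base Gamma))
    (Cons (code_seq code_nat (vertices Gamma))
       (code_seq (code_pair (code_pair code_nat (@code_gen A)) code_nat)
          (edges Gamma))).

Definition source (A : finType) (e : nat * A * nat) : nat := e.1.1.
Definition label (A : finType) (e : nat * A * nat) : A := e.1.2.
Definition target (A : finType) (e : nat * A * nat) : nat := e.2.

Definition step (A : finType) (Gamma : rooted_graph A) (p : nat)
  (x : letter A) (q : nat) : bool :=
  if x.2 then (q, x.1, p) \in edges Gamma else (p, x.1, q) \in edges Gamma.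

Fixpoint walk (A : finType) (Gamma : rooted_graph A) (p : nat) (w : word A)
  (q : nat) : Prop :=
  if w is x :: w' then exists2 r, step Gamma p x r & walk Gamma r w' q
  else p = q.

Definition well_formed (A : finType) (Gamma : rooted_graph A) : Prop :=
  base Gamma \in vertices Gamma /\
  (forall e, e \in edges Gamma ->
     source e \in vertices Gamma /\ target e \in vertices Gamma).

Definition connected (A : finType) (Gamma : rooted_graph A) : Prop :=
  forall p q, p \in vertices Gamma -> q \in vertices Gamma ->
    exists w, walk Gamma p w q.

Definition folded (A : finType) (Gamma : rooted_graph A) : Prop :=
  forall e f, e \in edges Gamma -> f \in edges Gamma -> e <> f ->
    source e = source f \/ target e = target f -> label e <> label f.

Definition incident (A : finType) (e : nat * A * nat) (p : nat) : Prop :=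
  source e = p \/ target e = p.

Definition reduced_rooted (A : finType) (Gamma : rooted_graph A) : Prop :=
  [/\ well_formed Gamma, connected Gamma, folded Gamma
    & forall p, p \in vertices Gamma -> p <> base Gamma ->
        exists e f, [/\ e \in edges Gamma, f \in edges Gamma, e <> f,
                        incident e p & incident f p]].

Definition stallings_like (A : finType) (G : groupType) (mu : word A -> G)
  (L : word A -> Prop) (H : G -> Prop) (Gamma : rooted_graph A) : Prop :=
  [/\ reduced_rooted Gamma,
      forall w, walk Gamma (base Gamma) w (base Gamma) -> H (mu w)
    & forall w, L w -> H (mu w) -> walk Gamma (base Gamma) w (base Gamma)].

Definition stallings_problem (A : finType) (G : groupType) (mu : word A -> G)
  (L : word A -> Prop) : problem :=
  {| instance := seq (word A); output := rooted_graph A;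
     code_instance := @code_words A; code_output := @code_rooted_graph A;
     valid := fun hs => all (@reduced A) hs;
     domain := fun hs => quasi_convex mu L (generated mu hs);
     answer := fun hs Gamma => stallings_like mu L (generated mu hs) Gamma |}.

Definition stallings_computable (A : finType) (G : groupType)
  (mu : word A -> G) (L : word A -> Prop) : Prop :=
  solvable (stallings_problem mu L).

Definition membership_problem (A : finType) (G : groupType) (mu : word A -> G)
  (L : word A -> Prop) : problem :=
  {| instance := (seq (word A) * word A)%type; output := bool;
     code_instance := code_pair (@code_words A) (@code_word A);
     code_output := code_bool;
     valid := fun i => all (@reduced A) i.1 /\ reduced i.2;
     domain := fun i => quasi_convex mu L (generated mu i.1);
     answer := fun i b => b <-> generated mu i.1 (mu i.2) |}.

Definition containment_problem (A : finType) (G : groupType)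
  (mu : word A -> G) (L : word A -> Prop) : problem :=
  {| instance := (seq (word A) * seq (word A))%type; output := bool;
     code_instance := code_pair (@code_words A) (@code_words A);
     code_output := code_bool;
     valid := fun i => all (@reduced A) i.1 /\ all (@reduced A) i.2;
     domain := fun i => quasi_convex mu L (generated mu i.1) /\
                        quasi_convex mu L (generated mu i.2);
     answer := fun i b =>
       b <-> forall g, generated mu i.1 g -> generated mu i.2 g |}.

Definition equality_problem (A : finType) (G : groupType)
  (mu : word A -> G) (L : word A -> Prop) : problem :=
  {| instance := (seq (word A) * seq (word A))%type; output := bool;
     code_instance := code_pair (@code_words A) (@code_words A);
     code_output := code_bool;
     valid := fun i => all (@reduced A) i.1 /\ all (@reduced A) i.2;
     domain := fun i => quasi_convex mu L (generated mu i.1) /\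
                        quasi_convex mu L (generated mu i.2);
     answer := fun i b =>
       b <-> forall g, generated mu i.1 g <-> generated mu i.2 g |}.

Definition least_constant_problem (A : finType) (G : groupType)
  (mu : word A -> G) (L : word A -> Prop) : problem :=
  {| instance := seq (word A); output := nat;
     code_instance := @code_words A; code_output := code_nat;
     valid := fun hs => all (@reduced A) hs;
     domain := fun hs => quasi_convex mu L (generated mu hs);
     answer := fun hs k =>
       quasi_convex_with mu L (generated mu hs) k /\
       forall k', quasi_convex_with mu L (generated mu hs) k' -> k <= k' |}.

Definition algorithmic_structure (A : finType) (G : groupType)
  (mu : word A -> G) (L : word A -> Prop) : Prop :=
  [/\ respecting_epimorphism mu, rational_structure mu L,
      representatives_computable mu L & stallings_computable mu L].

(* The program is chosen before the alphabet, the group and the automatic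
   structure: it only knows about them through the code of the automata. *)
Definition uniformly_solvable
  (P : forall (A : finType) (G : groupType),
         (word A -> G) -> (word A -> Prop) -> problem) : Prop :=
  exists p, forall (A : finType) (G : groupType) (mu : word A -> G)
    (L : word A -> Prop) (S : automata A),
    1 < #|A| -> algorithmic_structure mu L -> automatic_structure mu L S ->
    solves p (with_input (code_automata S) (P A G mu L)).

(* Main.v *)
From HB Require Import structures.
From mathcomp Require Import all_boot.
Require Import Defs.
From Stdlib Require Import Classical ClassicalEpsilon.

Set Implicit Arguments.
Unset Strict Implicit.
Unset Printing Implicit Defensive.

(* A subgroup H is handled through a finite automaton N that accepts an element
   w of L exactly when w represents an element of H; a Stallings-like graph,
   read as an automaton, is one. Membership and containment are decided by
   running N on L-representatives. By shortening runs in the product of N with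
   an automaton of L, the least constant of quasi-convexity can be computed by
   inspecting the words u v of L representing elements of H, with u and v no
   longer than a known bound, and this bound is itself a constant of
   quasi-convexity.

   Uniformly in an automatic structure, representatives and automata N are
   found by enumerating all trees until one of them is a certificate. That a
   word is trivial in G is certified by a chain from an L-word back to itself
   through the multiplier automata. That N is correct is certified by labeling
   its states by words representing cosets of H, which shows that N accepts
   elements of H only, and, for each generator h = a_1 ... a_n of H, by automata
   for the cosets H a_1 ... a_i, which show that acceptance by N is invariant
   under multiplication by h. Such certificates exist as soon as there is a
   Stallings-like graph for H, and conversely the existence of N makes H
   quasi-convex, so the search stops exactly on quasi-convex subgroups. *)

(** * Computable functions on trees *)

Fixpoint eqdata (x y : data) : bool :=
  match x, y with
  | Nil, Nil => true
  | Cons a b, Cons c d => eqdata a c && eqdata b d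
  | _, _ => false
  end.

Lemma eqdataP : Equality.axiom eqdata.
Proof.
elim=> [|a IHa b IHb] [|c d] /=; try by constructor.
apply: (iffP andP) => [[/IHa-> /IHb->] //|[<- <-]].
by split; [apply/IHa | apply/IHb].
Qed.

HB.instance Definition _ := hasDecEq.Build data eqdataP.

Definition dhead (x : data) : data := if x is Cons a _ then a else Nil.
Definition dtail (x : data) : data := if x is Cons _ b then b else Nil.

Fixpoint dl (x : data) : seq data := if x is Cons a b then a :: dl b else [::].
Definition ld (s : seq data) : data := foldr Cons Nil s.

Lemma ldK : cancel ld dl.
Proof. by elim=> //= x s ->. Qed.

Lemma dlK : cancel dl ld.
Proof. by elim=> //= a _ b /= ->. Qed.

Lemma eval_det p x y y' : eval p x y -> eval p x y' -> y = y'.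
Proof.
move=> e; elim: e y' => {p x y}.
- by move=> x y' e; inversion e.
- by move=> x y' e; inversion e.
- by move=> a b y' e; inversion e.
- by move=> y' e; inversion e.
- by move=> a b y' e; inversion e.
- by move=> y' e; inversion e.
- move=> p q x a b _ IHp _ IHq y' e; inversion e; subst.
  by rewrite (IHp _ H1) (IHq _ H4).
- move=> p q x y z _ IHp _ IHq y' e; inversion e; subst.
  by apply: IHq; rewrite (IHp _ H1).
- move=> c p q x a b y _ IHc _ IHp y' e; inversion e; subst; first exact: IHp.
  by have := IHc _ H4.
- move=> c p q x y _ IHc _ IHq y' e; inversion e; subst; last exact: IHq.
  by have := IHc _ H4.
- move=> c p x _ IHc y' e; inversion e; subst => //.
  by have := IHc _ H1.
- move=> c p x a b y z _ IHc _ IHp _ IHw y' e; inversion e; subst.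
    by have := IHc _ H3.
  by apply: IHw; rewrite (IHp _ H2).
Qed.

Lemma eval_seq p q x z :
  eval (PSeq p q) x z -> exists2 y, eval p x y & eval q y z.
Proof. by move=> e; inversion e; subst; exists y. Qed.

(** Total computability, with values in trees, in lists laid out as trees, and in booleans. The
    closure lemmas feed a hint database, so that [computable] proves computability by following the
    syntax of a function. *)
Definition cd (f : data -> data) : Prop := exists p, forall x, eval p x (f x).
Definition cl (f : data -> seq data) : Prop := cd (fun x => ld (f x)).
Definition cb (f : data -> bool) : Prop := cd (fun x => code_bool (f x)).

Lemma cd_ext f g : f =1 g -> cd f -> cd g.
Proof. by move=> fg [p pP]; exists p => x; rewrite -fg. Qed.

Lemma cd_id : cd (fun x => x).
Proof. by exists PId; constructor. Qed.

Lemma cd_head f : cd f -> cd (fun x => dhead (f x)).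
Proof.
case=> p pP; exists (PSeq p PHead) => x; apply: EvSeq (pP x) _.
by case: (f x); constructor.
Qed.

Lemma cd_tail f : cd f -> cd (fun x => dtail (f x)).
Proof.
case=> p pP; exists (PSeq p PTail) => x; apply: EvSeq (pP x) _.
by case: (f x); constructor.
Qed.

Lemma cd_cons f g : cd f -> cd g -> cd (fun x => Cons (f x) (g x)).
Proof. by case=> p pP [q qP]; exists (PCons p q); constructor. Qed.

Lemma cd_const d : cd (fun _ => d).
Proof.
elim: d => [|a IHa b IHb]; last exact: cd_cons.
by exists PNil; constructor.
Qed.

Lemma cd_comp f g : cd f -> cd g -> cd (fun x => g (f x)).
Proof.
by case=> p pP [q qP]; exists (PSeq p q) => x; apply: EvSeq (pP x) (qP _).
Qed.

Lemma cd_if b f g :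
  cb b -> cd f -> cd g -> cd (fun x => if b x then f x else g x).
Proof.
case=> c cP [p pP] [q qP]; exists (PIf c p q) => x; have := cP x.
by case: (b x) => /= e; [apply: EvIfTrue e _ | apply: EvIfFalse e _].
Qed.

Lemma cl_if b f g :
  cb b -> cl f -> cl g -> cl (fun x => if b x then f x else g x).
Proof. by move=> hb hf hg; apply: cd_ext (cd_if hb hf hg) => x; case: (b x). Qed.

Lemma cb_if b f g :
  cb b -> cb f -> cb g -> cb (fun x => if b x then f x else g x).
Proof. by move=> hb hf hg; apply: cd_ext (cd_if hb hf hg) => x; case: (b x). Qed.

Lemma cb_const b : cb (fun _ => b).
Proof. exact: cd_const. Qed.

Lemma cb_and f g : cb f -> cb g -> cb (fun x => f x && g x).
Proof. by move=> hf hg; apply: cb_if (cb_const false). Qed.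

Lemma cb_or f g : cb f -> cb g -> cb (fun x => f x || g x).
Proof. by move=> hf hg; apply: (cb_if hf (cb_const true) hg). Qed.

Lemma cb_neg f : cb f -> cb (fun x => ~~ f x).
Proof. by move=> hf; apply: (cb_if hf (cb_const false) (cb_const true)). Qed.

Lemma cb_imp f g : cb f -> cb g -> cb (fun x => f x ==> g x).
Proof. by move=> hf hg; apply: (cb_if hf hg (cb_const true)). Qed.

Definition nz (x : data) : bool := if x is Nil then false else true.

Lemma cb_nz f : cd f -> cb (fun x => nz (f x)).
Proof.
case=> p pP; exists (PIf p (PCons PNil PNil) PNil) => x; have := pP x.
case: (f x) => [|a b] e /=; first by apply: EvIfFalse e _; constructor.
by apply: EvIfTrue e _; do 2!constructor.
Qed.

Lemma cl_dl f : cd f -> cl (fun x => dl (f x)).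
Proof. by apply: cd_ext => x; rewrite dlK. Qed.

Lemma cd_ld f : cl f -> cd (fun x => ld (f x)).
Proof. by []. Qed.

Lemma cl_nil : cl (fun _ => [::]).
Proof. exact: cd_const. Qed.

Lemma cl_cons f g : cd f -> cl g -> cl (fun x => f x :: g x).
Proof. exact: cd_cons. Qed.

Create HintDb comp.
#[export] Hint Resolve cd_id cd_head cd_tail cd_cons cd_const cd_if cl_if cb_if
  cb_const cb_and cb_or cb_neg cb_imp cb_nz cl_dl cd_ld cl_nil cl_cons : comp.

Ltac computable := solve [auto 60 with comp nocore].

Lemma while_step c p x y x' z :
  eval c x y -> nz y -> eval p x x' -> eval (PWhile c p) x' z ->
  eval (PWhile c p) x z.
Proof. by case: y => // a b e _; apply: EvWhileStep e. Qed.

(** The store is a flag followed by a stack of pairs still to be compared. At the first mismatch the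
    whole store becomes [Nil], which both ends the loop and makes the flag read as false. *)
Definition eq_step (s : data) : data :=
  let a := dhead (dhead (dtail s)) in let b := dtail (dhead (dtail s)) in
  let rest := dtail (dtail s) in
  if nz a then
    if nz b then Cons (dhead s) (Cons (Cons (dhead a) (dhead b))
                   (Cons (Cons (dtail a) (dtail b)) rest))
    else Nil
  else if nz b then Nil else Cons (dhead s) rest.

Lemma cd_eq_step : cd eq_step.
Proof. by rewrite /eq_step /=; computable. Qed.

Lemma cb_eq f g : cd f -> cd g -> cb (fun x => f x == g x).
Proof.
move=> hf hg; have [p pP] := cd_eq_step.
pose W := PWhile PTail p.
have Wnil d : eval W (Cons d Nil) (Cons d Nil) by apply: EvWhileStop; constructor.
have Wfail : eval W Nil Nil by apply: EvWhileStop; constructor.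
(* The rest of the loop appears as a hypothesis, so that the induction can compare the left subtrees
   while the right ones wait on the stack. *)
have Weq a b d r z :
    eval W (if a == b then Cons d r else Nil) z ->
    eval W (Cons d (Cons (Cons a b) r)) z.
  elim: a b r => [|a1 IH1 a2 IH2] [|b1 b2] r e;
    apply: while_step (EvTail _ _) _ (pP _) _; rewrite /eq_step //=.
  have E : (Cons a1 a2 == Cons b1 b2) = (a1 == b1) && (a2 == b2) by [].
  apply: IH1; move: e; rewrite E; case: (a1 == b1) => //.
  exact: IH2.
have [q qP] : cd (fun x => Cons (Cons Nil Nil) (Cons (Cons (f x) (g x)) Nil)).
  by computable.
exists (PSeq q (PSeq W PHead)) => x; apply: EvSeq (qP x) _.
case: (boolP (f x == g x)) => E /=.
  by apply: (EvSeq (y := Cons (Cons Nil Nil) Nil)); [apply: Weq; rewrite E | constructor].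
by apply: (EvSeq (y := Nil)); [apply: Weq; rewrite (negbTE E) | constructor].
Qed.

(** The store holds a fixed parameter, the accumulator and the items left; [p] receives the
    parameter, the accumulator and the next item. *)
Definition fold_loop (p : program) : program :=
  PWhile (PSeq PTail PTail)
    (PCons PHead (PCons
       (PSeq (PCons PHead (PCons (PSeq PTail PHead) (PSeq PTail (PSeq PTail PHead)))) p)
       (PSeq PTail (PSeq PTail PTail)))).

(** The hypothesis bears on the items of [s] only, so that the loop can also run a partial program
    that stops on these items. *)
Lemma eval_fold_loop p (F : data -> data -> data) x a s :
  (forall b e, e \in s -> eval p (Cons x (Cons b e)) (F b e)) ->
  eval (fold_loop p) (Cons x (Cons a (ld s))) (Cons x (Cons (foldl F a s) Nil)).
Proof.
elim: s a => [|e s IH] a pP /=.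
  by apply: EvWhileStop; apply: EvSeq; constructor.
apply: EvWhileStep; first by apply: EvSeq; constructor.
  constructor; first by constructor.
  constructor; last by apply: EvSeq; [constructor | apply: EvSeq; constructor].
  apply: EvSeq (pP a e (mem_head _ _)).
  by do !(constructor || apply: EvSeq).
by apply: IH => b d ds; apply: pP; rewrite inE ds orbT.
Qed.

(** The first argument of [F] receives the whole input [x]: it plays the role of the environment of
    a closure. *)
Lemma cd_foldl (F : data -> data -> data -> data) f l :
  cd (fun y => F (dhead y) (dhead (dtail y)) (dtail (dtail y))) ->
  cd f -> cl l -> cd (fun x => foldl (F x) (f x) (l x)).
Proof.
move=> [p pP] hf hl.
have [q qP] : cd (fun x => Cons x (Cons (f x) (ld (l x)))) by computable.
exists (PSeq q (PSeq (fold_loop p) (PSeq PTail PHead))) => x.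
apply: EvSeq (qP x) _; apply: EvSeq; last by apply: EvSeq; constructor.
by apply: eval_fold_loop => b e _; apply: (pP (Cons _ (Cons _ _))).
Qed.

#[export] Hint Resolve cb_eq cd_foldl : comp.

Lemma cl_rev l : cl l -> cl (fun x => rev (l x)).
Proof.
move=> hl; apply: (@cd_ext (fun x => foldl (fun a e => Cons e a) Nil (l x))).
  by move=> x; rewrite -{1}(revK (l x)) foldl_rev.
by computable.
Qed.

Lemma cd_foldr (F : data -> data -> data -> data) f l :
  cd (fun y => F (dhead y) (dhead (dtail y)) (dtail (dtail y))) ->
  cd f -> cl l -> cd (fun x => foldr (F x) (f x) (l x)).
Proof.
move=> hF hf hl.
apply: (@cd_ext (fun x => foldl (fun a e => F x e a) (f x) (rev (l x)))).
  by move=> x; rewrite foldl_rev.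
apply: (cd_foldl (F := fun x a e => F x e a)) => //; last exact: cl_rev.
apply: (cd_comp (f := fun y => Cons (dhead y)
   (Cons (dtail (dtail y)) (dhead (dtail y)))) _ hF).
by computable.
Qed.

#[export] Hint Resolve cl_rev cd_foldr : comp.

Lemma cl_cat l l' : cl l -> cl l' -> cl (fun x => l x ++ l' x).
Proof.
move=> hl hl'; apply: (@cd_ext (fun x => foldr Cons (ld (l' x)) (l x))).
  by move=> x; rewrite /ld foldr_cat.
by computable.
Qed.

#[export] Hint Resolve cl_cat : comp.

Lemma cl_map (F : data -> data -> data) l :
  cd (fun y => F (dhead y) (dtail y)) -> cl l -> cl (fun x => map (F x) (l x)).
Proof.
move=> hF hl; apply: (@cd_ext (fun x => foldr (fun e a => Cons (F x e) a) Nil (l x))).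
  by move=> x; elim: (l x) => //= e s ->.
apply: (cd_foldr (F := fun x e a => Cons (F x e) a)); [|by computable..].
apply: cd_cons; last by computable.
apply: (cd_comp (f := fun y => Cons (dhead y) (dhead (dtail y))) _ hF).
by computable.
Qed.

Lemma cl_flatten_map (F : data -> data -> seq data) l :
  cl (fun y => F (dhead y) (dtail y)) -> cl l ->
  cl (fun x => flatten (map (F x) (l x))).
Proof.
move=> hF hl.
apply: (@cd_ext (fun x => foldr (fun e a => ld (F x e ++ dl a)) Nil (l x))).
  by move=> x; elim: (l x) => //= e s ->; rewrite ldK.
apply: (cd_foldr (F := fun x e a => ld (F x e ++ dl a))); [|by computable..].
apply: cl_cat; last by computable.
apply: (cd_comp (f := fun y => Cons (dhead y) (dhead (dtail y))) _ hF).
by computable.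
Qed.

Lemma cl_filter (P : data -> data -> bool) l :
  cb (fun y => P (dhead y) (dtail y)) -> cl l ->
  cl (fun x => filter (P x) (l x)).
Proof.
move=> hP hl.
apply: (@cd_ext (fun x => ld (flatten (map (fun e => if P x e then [:: e] else [::]) (l x))))).
  by move=> x; congr ld; elim: (l x) => //= e s ->; case: ifP.
apply: (cl_flatten_map (F := fun x e => if P x e then [:: e] else [::])) => //.
by apply: cl_if => //; computable.
Qed.

Lemma cb_all (P : data -> data -> bool) l :
  cb (fun y => P (dhead y) (dtail y)) -> cl l ->
  cb (fun x => all (P x) (l x)).
Proof.
move=> hP hl.
apply: (@cd_ext (fun x => foldr (fun e a => if P x e then a else Nil) (Cons Nil Nil) (l x))).
  by move=> x; elim: (l x) => //= e s ->; case: (P x e).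
apply: (cd_foldr (F := fun x e a => if P x e then a else Nil)); [|by computable..].
apply: cd_if; [|by computable..].
apply: (cd_comp (f := fun y => Cons (dhead y) (dhead (dtail y))) _ hP).
by computable.
Qed.

Lemma cb_has (P : data -> data -> bool) l :
  cb (fun y => P (dhead y) (dtail y)) -> cl l ->
  cb (fun x => has (P x) (l x)).
Proof.
move=> hP hl; apply: (@cd_ext (fun x => code_bool (~~ all (predC (P x)) (l x)))).
  by move=> x; rewrite -has_predC; congr code_bool; apply: eq_has => e /=; rewrite negbK.
by apply: cb_neg; apply: (cb_all (P := fun x => predC (P x))) => //; apply: cb_neg.
Qed.

#[export] Hint Resolve cl_map cl_flatten_map cl_filter cb_all cb_has : comp.

Lemma cb_mem f l : cd f -> cl l -> cb (fun x => f x \in l x).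
Proof.
move=> hf hl; apply: (@cd_ext (fun x => code_bool (has (fun e => f x == e) (l x)))).
  by move=> x; congr code_bool; rewrite -has_pred1; apply: eq_has => e; rewrite eq_sym.
apply: (cb_has (P := fun x e => f x == e)) => //; apply: cb_eq; last by computable.
by apply: (cd_comp (g := f)) => //; computable.
Qed.

#[export] Hint Resolve cb_mem : comp.

Lemma cb_eqb f g : cb f -> cb g -> cb (fun x => f x == g x).
Proof.
move=> hf hg; have h : cb (fun x => if f x then g x else ~~ g x) by computable.
by apply: cd_ext h => x; case: (f x); case: (g x).
Qed.

Definition dfind (P : data -> bool) (s : seq data) : data :=
  foldr (fun e a => if P e then e else a) Nil s.

Lemma dfindP P s : has P s -> P (dfind P s).
Proof. by elim: s => //= e s IH; case: (boolP (P e)). Qed.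

Lemma cd_dfind (P : data -> data -> bool) l :
  cb (fun y => P (dhead y) (dtail y)) -> cl l ->
  cd (fun x => dfind (P x) (l x)).
Proof.
move=> hP hl.
apply: (cd_foldr (F := fun x e a => if P x e then e else a)); [|by computable..].
apply: cd_if; [|by computable..].
apply: (cd_comp (f := fun y => Cons (dhead y) (dhead (dtail y))) _ hP).
by computable.
Qed.

#[export] Hint Resolve cb_eqb cd_dfind : comp.

(** * Enumeration of all trees and unbounded search *)

Definition deeper (T : seq data) : seq data :=
  Nil :: flatten (map (fun a => map (fun b => Cons a b) T) T).

Lemma cl_deeper f : cl f -> cl (fun x => deeper (f x)).
Proof.
move=> hf.
suff h : cl (fun x => deeper (dl x)).
  by apply: (@cd_ext (fun x => ld (deeper (dl (ld (f x))))));
    [move=> x; rewrite ldK | exact: (cd_comp hf h)].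
by rewrite /deeper; computable.
Qed.

Lemma deeperS m n : m <= n -> {subset iter m deeper [::] <= iter n deeper [::]}.
Proof.
elim: n m => [|n IH] [|m] //= mn d; rewrite !inE.
case/orP=> [->//|/flatten_mapP [a am /mapP [b bm ->]]].
by apply/orP; right; apply/flatten_mapP; exists a; [|apply: map_f]; exact: IH mn _ _.
Qed.

Lemma deeper_all (d : data) : exists n, d \in iter n deeper [::].
Proof.
elim: d => [|a [m am] b [n bn]]; first by exists 1.
exists (maxn m n).+1; rewrite /= inE; apply/orP; right; apply/flatten_mapP.
exists a; first by apply: deeperS am; apply: leq_maxl.
by apply: map_f; apply: deeperS bn; apply: leq_maxr.
Qed.

Arguments deeper : simpl never.

(** The loop replaces a list of candidates [T] by [deeper T] until one of them satisfies [P]; the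
    iterates exhaust all trees. The second clause is what later yields divergence when no
    certificate exists. *)
Lemma search (P : data -> data -> bool) :
  cb (fun y => P (dhead y) (dtail y)) ->
  exists p, forall x,
    ((exists d, P x d) -> exists2 d, P x d & eval p x d) /\
    (stops p x -> exists d, P x d).
Proof.
move=> hP.
have [c cP] : cb (fun y => ~~ has (P (dhead y)) (dl (dtail y))).
  apply: cb_neg; apply: (cb_has (P := fun y e => P (dhead y) e)); last by computable.
  by apply: (cd_comp (f := fun y => Cons (dhead (dhead y)) (dtail y)) _ hP); computable.
have [p pP] : cd (fun y => Cons (dhead y) (ld (deeper (dl (dtail y))))).
  by apply: cd_cons; [|apply: cl_deeper]; computable.
have [q qP] : cd (fun y => dfind (P (dhead y)) (dl (dtail y))).
  apply: (cd_dfind (P := fun y e => P (dhead y) e)); last by computable.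
  by apply: (cd_comp (f := fun y => Cons (dhead (dhead y)) (dtail y)) _ hP); computable.
pose W := PWhile c p.
exists (PSeq (PCons PId PNil) (PSeq W q)) => x; split=> [[d Pd]|[y e]].
  have [n dn] := deeper_all d.
  have : exists m, has (P x) (iter m deeper [::]).
    by exists n; apply/hasP; exists d.
  case/ex_minnP=> m Pm min.
  exists (dfind (P x) (iter m deeper [::])); first exact: dfindP.
  apply: (EvSeq (y := Cons x (ld [::]))); first by do 2!constructor.
  apply: (EvSeq (y := Cons x (ld (iter m deeper [::])))); last first.
    by have := qP (Cons x (ld (iter m deeper [::]))); rewrite /= ldK.
  (* Induction on the number [k] of rounds left before the first successful round [m]. *)
  suff run k : k <= m -> eval W (Cons x (ld (iter (m - k) deeper [::])))
      (Cons x (ld (iter m deeper [::]))).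
    by have := run m (leqnn m); rewrite subnn.
  elim: k => [_|k IH km].
    rewrite subn0; apply: EvWhileStop.
    by have := cP (Cons x (ld (iter m deeper [::]))); rewrite /= ldK Pm.
  have := cP (Cons x (ld (iter (m - k.+1) deeper [::]))).
  have := pP (Cons x (ld (iter (m - k.+1) deeper [::]))).
  rewrite [dhead _]/= [dtail _]/= ldK => ep ec; apply: while_step ec _ ep _.
    by case: has (min (m - k.+1)) => // /(_ isT); rewrite leqNgt ltn_subrL (leq_ltn_trans _ km).
  by rewrite -iterS subnSK //; apply: IH; apply: ltnW.
case/eval_seq: e => s0 es0 /eval_seq [s1 e _].
have E0 : s0 = Cons x Nil by apply: eval_det es0 _; do 2!constructor.
subst s0.
(* Invariant of the loop, by induction on the evaluation: the input is kept in the store, and the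
   loop is left only with a successful candidate. *)
suff H s s' : eval W s s' -> has (P (dhead s)) (dl (dtail s')) /\ dhead s' = dhead s.
  by have [/hasP [d _ Pd] _] := H _ _ e; exists d.
move=> {}e; move: e; move E: W => w e.
elim: e E => // {s s' s1}.
  move=> c0 p0 s ec _ [? ?]; subst.
  by have := eval_det ec (cP s); case: has.
move=> c0 p0 s a b s1 s2 ec _ ep _ _ IH [? ?]; subst.
by have := eval_det ep (pP s) => ?; subst; have := IH erefl.
Qed.

(** * Automata *)

Lemma cd_comp2 (F : data -> data -> data) f g :
  cd (fun y => F (dhead y) (dtail y)) -> cd f -> cd g ->
  cd (fun x => F (f x) (g x)).
Proof. by move=> hF hf hg; apply: (cd_comp (cd_cons hf hg) hF). Qed.

Lemma cd_comp3 (F : data -> data -> data -> data) f g h :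
  cd (fun y => F (dhead y) (dhead (dtail y)) (dtail (dtail y))) ->
  cd f -> cd g -> cd h -> cd (fun x => F (f x) (g x) (h x)).
Proof.
by move=> hF hf hg hh; apply: (cd_comp (cd_cons hf (cd_cons hg hh)) hF).
Qed.

Lemma code_seqE X (code : X -> data) s : code_seq code s = ld (map code s).
Proof. by elim: s => //= x s ->. Qed.

Lemma dl_code_seq X (code : X -> data) s : dl (code_seq code s) = map code s.
Proof. by rewrite code_seqE ldK. Qed.

Lemma code_nat_inj : injective code_nat.
Proof.
move=> m n e; have sz k : size (dl (code_nat k)) = k by elim: k => //= k ->.
by rewrite -(sz m) e sz.
Qed.

(* An automaton whose states and letters are arbitrary trees, laid out as in
   [code_automaton]. *)
Definition dinit (N : data) : seq data := dl (dhead N).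
Definition dfinal (N : data) : seq data := dl (dhead (dtail N)).
Definition dtrans (N : data) : seq data := dl (dtail (dtail N)).

Definition dsrc (t : data) : data := dhead (dhead t).
Definition dlab (t : data) : data := dtail (dhead t).
Definition ddst (t : data) : data := dtail t.

Fixpoint drun (T : seq data) (p : data) (w : seq data) (q : data) : Prop :=
  if w is x :: w' then
    exists t, [/\ t \in T, dsrc t = p, dlab t = x & drun T (ddst t) w' q]
  else p = q.

Lemma drun_cat T p u v q :
  drun T p (u ++ v) q <-> exists2 r, drun T p u r & drun T r v q.
Proof.
elim: u p => [|x u IH] p /=.
  by split=> [h|[r -> //]]; exists p.
split=> [[t [tT tp tx /IH [r h1 h2]]]|[r [t [tT tp tx h1]] h2]].
  by exists r => //; exists t.
by exists t; split=> //; apply/IH; exists r.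
Qed.

(** Subset construction on the fly: [S] is a list of states laid out as a tree, which turns
    nondeterministic acceptance into a computable boolean. *)
Definition dstep (N S x : data) : data :=
  ld [seq ddst t | t <- dtrans N & (dsrc t \in dl S) && (dlab t == x)].

Definition daccept (N S : data) : bool := has (fun s => s \in dfinal N) (dl S).

Definition nacc (N : data) (w : seq data) : bool :=
  daccept N (foldl (dstep N) (dhead N) w).

Lemma dreachP N S w q :
  q \in dl (foldl (dstep N) S w) <->
  exists2 p, p \in dl S & drun (dtrans N) p w q.
Proof.
elim: w S => [|x w IH] S /=; first by split=> [qS|[p pS <- //]]; exists q.
rewrite IH /dstep ldK; split=> [[r /mapP [t] ]|[p pS [t [tT tp tx h]]]].
  rewrite mem_filter => /andP [/andP [tS /eqP tx] tT] -> h.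
  by exists (dsrc t) => //; exists t.
exists (ddst t) => //; apply: map_f.
by rewrite mem_filter tp pS tx eqxx.
Qed.

Lemma naccP N w :
  nacc N w <-> exists p q, [/\ p \in dinit N, q \in dfinal N &
                               drun (dtrans N) p w q].
Proof.
split=> [/hasP [q /dreachP [p pi h] qf]|[p [q [pi qf h]]]]; first by exists p, q.
by apply/hasP; exists q => //; apply/dreachP; exists p.
Qed.

Section Code.
Variables (X : eqType) (code : X -> data).

Lemma run_code T p dz dq :
  drun [seq code_pair (code_pair code_nat code) code_nat t | t <- T]
    (code_nat p) dz dq <->
  exists z q, [/\ dz = map code z, dq = code_nat q & run T p z q].
Proof.
elim: dz p => [|x dz IH] p /=; split.
- by move=> <-; exists [::], p.
- by case=> z [q []]; case: z => //= _ -> ->.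
- case=> t [/mapP [[[p' y] r] tT ->] /code_nat_inj /= ep <- /IH].
  case=> z [q [-> -> h]]; exists (y :: z), q; split=> //=.
  by exists r; rewrite -?ep.
- case=> z [q []]; case: z => //= y z [-> ez] eq [r tT h].
  exists (code_pair (code_pair code_nat code) code_nat (p, y, r)); split=> //.
    exact: map_f.
  by apply: (proj2 (IH r)); exists z, q.
Qed.

Lemma nacc_code M dz :
  nacc (code_automaton code M) dz <->
  exists2 z, dz = map code z & accepts M z.
Proof.
rewrite naccP /dinit /dfinal /dtrans /= !dl_code_seq; split.
  case=> _ [dq [/mapP [p pi ->] /mapP [q qf ->] /run_code]].
  by case=> z [q' [-> /code_nat_inj <- h]]; exists z => //; exists p, q.
case=> z -> [p [q [pi qf h]]].
exists (code_nat p), (code_nat q); split; [exact: map_f..|].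
by apply/run_code; exists z, q.
Qed.
End Code.

Lemma cd_dstep f g h :
  cd f -> cd g -> cd h -> cd (fun x => dstep (f x) (g x) (h x)).
Proof.
by apply: cd_comp3; rewrite /dstep /dtrans /dsrc /dlab /ddst; computable.
Qed.

#[export] Hint Resolve cd_dstep : comp.

Lemma cb_daccept f g : cd f -> cd g -> cb (fun x => daccept (f x) (g x)).
Proof.
apply: (cd_comp2 (F := fun N S => code_bool (daccept N S))).
by rewrite -/(cb _) /daccept /dfinal; computable.
Qed.

#[export] Hint Resolve cb_daccept : comp.

Lemma cb_nacc f l : cd f -> cl l -> cb (fun x => nacc (f x) (l x)).
Proof.
move=> hf hl; apply: (@cd_ext (fun x => code_bool (nacc (f x) (dl (ld (l x)))))).
  by move=> x; rewrite ldK.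
apply: (cd_comp2 (F := fun N w => code_bool (nacc N (dl w)))) => //.
by rewrite -/(cb _) /nacc; computable.
Qed.

#[export] Hint Resolve cb_nacc : comp.

(** * Shortening two simultaneous runs *)

Section Pumping.
Variables (al T T' : seq data).

(** Letters outside [al] are barred, so that a shortened run still reads a word over the intended
    alphabet. *)
Definition common (t t' : data) : bool := (dlab t == dlab t') && (dlab t \in al).

Definition pair_step (s s' : data * data) : bool :=
  has (fun t => has (fun t' => [&& common t t', (dsrc t, dsrc t') == s
    & (ddst t, ddst t') == s']) T') T.

Lemma pair_stepP s s' :
  reflect (exists t t', [/\ t \in T, t' \in T', common t t',
                         (dsrc t, dsrc t') = s & (ddst t, ddst t') = s'])
          (pair_step s s').
Proof.
apply: (iffP hasP) => [[t tT /hasP [t' tT' /and3P [c /eqP e /eqP e']]]|].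
  by exists t, t'.
case=> t [t' [tT tT' c e e']]; exists t => //; apply/hasP; exists t' => //.
by rewrite c e e' !eqxx.
Qed.

Lemma pair_pathP s s' w :
  all (mem al) w -> drun T s.1 w s'.1 -> drun T' s.2 w s'.2 ->
  exists2 p, path pair_step s p & last s p = s'.
Proof.
elim: w s => [|x w IH] s /=.
  by move=> _ e e'; exists [::]; rewrite //= [s]surjective_pairing e e' -surjective_pairing.
case/andP=> xal wal [t [tT ts tx h]] [t' [tT' ts' tx' h']].
have [p pp lp] := IH (ddst t, ddst t') wal h h'.
exists ((ddst t, ddst t') :: p) => //=; rewrite pp andbT; apply/pair_stepP.
by exists t, t'; rewrite ts ts' -surjective_pairing /common tx tx' eqxx.
Qed.

Lemma path_pairP s p :
  path pair_step s p ->
  exists w, [/\ size w = size p, all (mem al) w,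
              drun T s.1 w (last s p).1 & drun T' s.2 w (last s p).2].
Proof.
elim: p s => [|s' p IH] s /=; first by exists [::].
case/andP=> /pair_stepP [t [t' [tT tT' /andP [/eqP e tal] <- <-]]] /IH.
case=> w [sw wal h h']; exists (dlab t :: w); split=> /=; rewrite ?sw ?tal //.
  by exists t.
by exists t'.
Qed.

(** Two runs on the same word form one path in the graph of pairs of states. Once its cycles are cut
    out, the vertices after the first are distinct and are targets of pairs of transitions, whence
    the bound. *)
Lemma short_run p p' w q q' :
  all (mem al) w -> drun T p w q -> drun T' p' w q' ->
  exists w', [/\ size w' <= size [seq (ddst t, ddst t') | t <- T, t' <- T'],
    all (mem al) w', drun T p w' q & drun T' p' w' q'].
Proof.
move=> wal h h'; have [r rp lr] := pair_pathP (s := (p, p')) (s' := (q, q')) wal h h'.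
case/shortenP: rp lr => r' r'p /= /andP [_ ur'] _ lr.
have [w' [sw' w'al]] := path_pairP r'p; rewrite lr => k k'.
exists w'; split=> //; rewrite sw'; apply: uniq_leq_size => //.
move: r'p {lr k k' sw' ur'}; elim: r' (p, p') => //= s r' IH s0.
case/andP=> /pair_stepP [t [t' [tT tT' _ _ <-]]] /IH sub x.
rewrite inE => /orP [/eqP -> | /sub //].
by apply/allpairsP; exists (t, t').
Qed.
End Pumping.

(** * Words and quasi-convexity *)

Definition dlinv (x : data) : data :=
  Cons (dhead x) (if nz (dtail x) then Nil else Cons Nil Nil).
Definition dinv (s : seq data) : seq data := rev (map dlinv s).

(** Free reduction, adding letters from the right end to an already reduced word. It prepares inputs
    for programs that are specified on reduced words. *)
Definition push (x s : data) : data :=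
  if nz s && (dhead s == dlinv x) then dtail s else Cons x s.
Definition dreduce (s : seq data) : seq data := dl (foldr push Nil s).

Lemma cd_dlinv f : cd f -> cd (fun x => dlinv (f x)).
Proof. by move=> hf; apply: (cd_comp hf); rewrite /dlinv; computable. Qed.

#[export] Hint Resolve cd_dlinv : comp.

Lemma cl_dinv f : cl f -> cl (fun x => dinv (f x)).
Proof.
move=> hf; rewrite /dinv; apply: cl_rev.
by apply: (cl_map (F := fun _ => dlinv)) => //; computable.
Qed.

Lemma cl_dreduce f : cl f -> cl (fun x => dreduce (f x)).
Proof.
move=> hf; apply: cl_dl; apply: (cd_foldr (F := fun _ => push)); [|by computable..].
by rewrite /push; computable.
Qed.

#[export] Hint Resolve cl_dinv cl_dreduce : comp.

(* [clock] is a bound on lengths, written in unary. *)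
Definition dwords (al clock : seq data) : seq data :=
  dl (foldl (fun W _ => Cons Nil (ld (flatten
        (map (fun x => map (fun w => Cons x w) (dl W)) al))))
     (Cons Nil Nil) clock).

Lemma cl_dwords f g : cl f -> cl g -> cl (fun x => dwords (f x) (g x)).
Proof.
move=> hf hg.
apply: (@cd_ext (fun x => ld (dwords (dl (ld (f x))) (dl (ld (g x)))))).
  by move=> x; rewrite !ldK.
apply: (cd_comp2 (F := fun a b => ld (dwords (dl a) (dl b)))) => //.
by rewrite /dwords; apply: cl_dl; computable.
Qed.

#[export] Hint Resolve cl_dwords : comp.

Lemma mem_dwords al clock d :
  (d \in dwords al clock) = all (mem al) (dl d) && (size (dl d) <= size clock).
Proof.
elim/last_ind: clock d => [|s y IH] d.
  by rewrite /dwords /= inE; case: d => //= a b; rewrite andbF.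
rewrite /dwords foldl_rcons size_rcons /= inE ldK.
have mem_deeper : (d \in flatten [seq [seq Cons x w | w <- dwords al s] | x <- al])
    = if d is Cons a b then (a \in al) && (b \in dwords al s) else false.
  apply/flatten_mapP/idP => [[x xal /mapP [w ws ->]]|]; first by rewrite xal.
  by case: d => //= a b /andP [aal bs]; exists a => //; apply: map_f.
rewrite -/(dwords al s) mem_deeper.
by case: d {mem_deeper} => //= a b; rewrite IH andbA.
Qed.

Section Words.
Variable A : finType.
Implicit Types (x : letter A) (u v w : word A).

Definition cw w : seq data := map (@code_letter A) w.
Definition winv w : word A := rev (map (@linv A) w).

Lemma code_wordE w : code_word w = ld (cw w).
Proof. exact: code_seqE. Qed.

Lemma cw_cat u v : cw (u ++ v) = cw u ++ cw v.
Proof. exact: map_cat. Qed.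

Lemma code_letter_inj : injective (@code_letter A).
Proof.
move=> [a b] [a' b'] [/code_nat_inj /ord_inj /enum_rank_inj ->].
by case: b; case: b'.
Qed.

Lemma cw_inj : injective cw.
Proof. exact: inj_map code_letter_inj. Qed.

Lemma cw_split w s t : cw w = s ++ t -> exists u v,
  [/\ w = u ++ v, s = cw u & t = cw v].
Proof.
move=> e; exists (take (size s) w), (drop (size s) w).
by rewrite cat_take_drop /cw map_take map_drop -/(cw w) e take_size_cat // drop_size_cat.
Qed.

Lemma dlinv_code x : dlinv (code_letter x) = code_letter (linv x).
Proof. by case: x => a []. Qed.

Lemma cw_inv w : cw (winv w) = dinv (cw w).
Proof.
rewrite /cw /winv /dinv map_rev -!map_comp; congr rev.
by apply: eq_map => x; rewrite /= dlinv_code.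
Qed.

Lemma winvK : involutive winv.
Proof.
move=> w; rewrite /winv map_rev revK -map_comp map_id_in // => -[a b] _.
by rewrite /= /linv /= negbK.
Qed.
End Words.

Section Group.
Variables (A : finType) (G : groupType) (mu : word A -> G).
Hypothesis muP : respecting_epimorphism mu.
Local Open Scope group_scope.

Lemma mu_nil : mu [::] = 1. Proof. by case: muP. Qed.
Lemma mu_cat u v : mu (u ++ v) = mu u * mu v. Proof. by case: muP. Qed.
Lemma mu_cons x u : mu (x :: u) = mu [:: x] * mu u. Proof. exact: mu_cat [:: x] u. Qed.

Lemma mu_inv w : mu (winv w) = (mu w)^-1.
Proof.
elim: w => [|x w IH]; first by rewrite mu_nil invg1.
rewrite mu_cons invgM -IH -(let: And4 _ _ h _ := muP in h) -mu_cat.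
by rewrite /winv /= rev_cons cats1.
Qed.

Lemma generated_subgroup hs : is_subgroup (generated mu hs).
Proof.
split=> [H [H1 _ _] _ //|x y hx hy H sH hH|x hx H sH hH].
  by case: (sH) => _ HM _; apply: HM; [apply: hx | apply: hy].
by case: (sH) => _ _ HV; apply: HV; apply: hx.
Qed.

Lemma generated_mem hs h : h \in hs -> generated mu hs (mu h).
Proof. by move=> hhs H _; apply. Qed.

Lemma dreduce_word w : exists w', [/\ reduced w', mu w' = mu w &
  dreduce (cw w) = cw w'].
Proof.
rewrite /dreduce; elim: w => [|x w [w' [rw' ew' dw']]]; first by exists [::].
have -> : foldr push Nil (cw (x :: w)) = push (code_letter x) (ld (cw w')).
  by rewrite -dw' dlK.
case: w' rw' ew' {dw'} => [|y w'] rw' ew'.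
  by exists [:: x]; rewrite mu_cons [mu (x :: w)]mu_cons ew'.
rewrite /push /= dlinv_code (inj_eq (@code_letter_inj A)); case: eqP => [e|ne].
  exists w'; rewrite ldK; split=> //; first exact: path_sorted rw'.
  rewrite [mu (x :: w)]mu_cons -ew' [mu (y :: w')]mu_cons e.
  by rewrite (let: And4 _ _ h _ := muP in h) mulVKg.
exists [:: x, y & w']; rewrite /= ldK; split=> //; first by apply/andP; split; [apply/eqP|].
by rewrite mu_cons ew' -mu_cons.
Qed.
End Group.

Section Quasiconvexity.
Variables (A : finType) (G : groupType) (mu : word A -> G).
Hypothesis muP : respecting_epimorphism mu.
Variables (L : word A -> Prop) (H : G -> Prop) (al : seq data) (M N : data).
Hypothesis sH : is_subgroup H.
Hypothesis alP : forall d, d \in al <-> exists x : letter A, d = code_letter x.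
Hypothesis LM : forall w, L w <-> nacc M (cw w).
Hypothesis NH : forall w, L w -> (nacc N (cw w) <-> H (mu w)).
Local Open Scope group_scope.

(** Only the length matters: it is the bound of [short_run], kept in unary so that programs can
    iterate along it. *)
Definition clock : seq data :=
  [seq Cons (ddst t) (ddst t') | t <- dtrans M, t' <- dtrans N].

Lemma all_alphabet s : all (mem al) s <-> exists w : word A, s = cw w.
Proof.
split=> [|[w ->]]; last first.
  by rewrite all_map; apply/allP => x _ /=; apply/alP; exists x.
elim: s => [|d s IH] /=; first by exists [::].
by case/andP=> /alP [x ->] /IH [w ->]; exists (x :: w).
Qed.

(** The runs of [M] and [N] on [u] and on [v] are shortened separately with the same end states. The
    pieces are then interchangeable: u v', u' v and u' v' all lie in [L] and represent elements of
    [H]. *)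
Lemma short_split u v : L (u ++ v) -> H (mu (u ++ v)) ->
  exists u' v', [/\ size u' <= size clock, size v' <= size clock,
    L (u' ++ v'), H (mu (u' ++ v')) & H (mu u * mu v') /\ H (mu u' * mu v)].
Proof.
move=> Luv Huv.
have [p [q [pM qM rM]]] := (naccP _ _).1 ((LM _).1 Luv).
have [p' [q' [pN qN rN]]] := (naccP _ _).1 ((NH Luv).2 Huv).
move: rM rN; rewrite cw_cat => /drun_cat [m rM1 rM2] /drun_cat [n rN1 rN2].
have al_cw (w : word A) : all (mem al) (cw w) by apply/all_alphabet; exists w.
have [u1 [su uA rMu rNu]] := short_run (al_cw u) rM1 rN1.
have [v1 [sv vA rMv rNv]] := short_run (al_cw v) rM2 rN2.
have [u' eu] := (all_alphabet _).1 uA; have [v' ev] := (all_alphabet _).1 vA.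
subst u1 v1; rewrite /cw !size_map !size_allpairs in su sv.
have both a b : drun (dtrans M) p (cw a) m -> drun (dtrans M) m (cw b) q ->
    drun (dtrans N) p' (cw a) n -> drun (dtrans N) n (cw b) q' ->
    L (a ++ b) /\ H (mu (a ++ b)).
  move=> h1 h2 h3 h4.
  have Lab : L (a ++ b).
    by apply/LM/naccP; exists p, q; split; rewrite ?cw_cat //; apply/drun_cat; exists m.
  split=> //; apply/(NH Lab)/naccP; exists p', q'; split; rewrite ?cw_cat //.
  by apply/drun_cat; exists n.
exists u', v'; rewrite /clock !size_allpairs; split=> //.
- by have [] := both u' v' rMu rMv rNu rNv.
- by have [] := both u' v' rMu rMv rNu rNv.
- rewrite -!(mu_cat muP); split.
    by have [] := both u v' rM1 rMv rN1 rNv.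
  by have [] := both u' v rMu rM2 rNu rN2.
Qed.

Definition near k (g : G) : Prop := exists2 z : word A, size z <= k & H (g * mu z).

Lemma quasi_convex_near k : quasi_convex_with mu L H k <->
  forall u v, L (u ++ v) -> H (mu (u ++ v)) -> near k (mu u).
Proof.
split=> [qc u v Luv Huv|h w Lw Hw u v e].
  by have [h Hh [z [zk e]]] := qc _ Luv Huv u v erefl; exists z; rewrite ?e.
subst w; have [z zk Hz] := h _ _ Lw Hw.
by exists (mu u * mu z) => //; exists z.
Qed.

(** The short word v' leads from [u] into [H]. Thus the mere existence of a recognizer [N] makes [H]
    quasi-convex. *)
Lemma quasi_convex_clock : quasi_convex_with mu L H (size clock).
Proof.
apply/quasi_convex_near => u v Luv Huv.
by have [u' [v' [_ sv _ _ [h _]]]] := short_split Luv Huv; exists v'.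
Qed.

(** As u v' and u' v' both represent elements of [H], the prefixes [u] and u' lie in the same right
    coset of [H], and the same [z] leads both into [H]. Only finitely many splits remain to be
    inspected. *)
Lemma quasi_convex_short k : quasi_convex_with mu L H k <->
  forall u v, size u <= size clock -> size v <= size clock ->
    L (u ++ v) -> H (mu (u ++ v)) -> near k (mu u).
Proof.
rewrite quasi_convex_near; split=> [h u v _ _|h u v Luv Huv]; first exact: h.
have [u' [v' [su sv Luv' Huv' [h1 h2]]]] := short_split Luv Huv.
have [z zk Hz] := h _ _ su sv Luv' Huv'; exists z => //.
case: sH => _ HM HV.
have -> : mu u * mu z = (mu u * mu v') * (mu u' * mu v')^-1 * (mu u' * mu z).
  by rewrite invgM !mulgA mulgK mulgVK.
by apply: (HM) Hz; apply: HM h1 (HV _ _); rewrite -(mu_cat muP).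
Qed.
End Quasiconvexity.

(** * The four problems, relative to representatives and recognizers *)

Lemma eval_pcons p q x z : eval (PCons p q) x z ->
  exists a b, [/\ eval p x a, eval q x b & z = Cons a b].
Proof. by move=> e; inversion e; subst; exists a, b. Qed.

(** In contrast to [cl_map], the program [q] may be partial: it has to stop on the items at hand,
    and [f] names its results there. *)
Lemma eval_map q : exists p, forall (f : data -> data) s,
  (forall e, e \in s -> eval q e (f e)) -> eval p (ld s) (ld (map f s)).
Proof.
have [r rP] : cd (fun y => ld (rev (dl (dhead (dtail y))))) by computable.
exists (PSeq (PCons PNil (PCons PNil PId)) (PSeq (fold_loop
  (PCons (PSeq (PSeq PTail PTail) q) (PSeq PTail PHead))) r)) => f s qP.
apply: EvSeq; first by do !constructor.
apply: EvSeq; first apply: (eval_fold_loop (F := fun b e => Cons (f e) b)).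
  move=> b e es; constructor; last by do !(constructor || apply: EvSeq).
  by apply: EvSeq (qP _ es); do !(constructor || apply: EvSeq).
have := rP (Cons Nil (Cons (foldl (fun b e => Cons (f e) b) Nil s) Nil)).
have -> : foldl (fun b e => Cons (f e) b) Nil s = ld (map f (rev s)).
  by rewrite -{1}(revK s) foldl_rev; elim: (rev s) => //= e t ->.
by rewrite /= ldK map_rev revK.
Qed.

(** A common interface to subgroups for the two halves of the theorem: [N] comes from a
    Stallings-like graph when the structure is fixed, and from a certificate in the uniform case. *)
Definition recognizer_problem (A : finType) (G : groupType) (mu : word A -> G)
  (L : word A -> Prop) : problem :=
  {| instance := seq (word A); output := data;
     code_instance := @code_words A; code_output := id;
     valid := fun hs => all (@reduced A) hs;
     domain := fun hs => quasi_convex mu L (generated mu hs);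
     answer := fun hs N =>
       forall w, L w -> (nacc N (cw w) <-> generated mu hs (mu w)) |}.

(** The input [c] describes the structure: it is the code of the automata in the uniform case, and
    [Nil] when the structure is built into the programs. [aut] turns it into the alphabet and an
    automaton for [L]. *)
Definition oracles (A : finType) (G : groupType) (mu : word A -> G)
  (L : word A -> Prop) (c : data) (rep stal aut : program) : Prop :=
  [/\ respecting_epimorphism mu,
      forall u : word A, reduced u -> exists w : word A,
        [/\ L w, mu w = mu u & eval rep (Cons c (code_word u)) (code_word w)],
      solves stal (with_input c (recognizer_problem mu L))
    & exists al M, [/\ eval aut c (Cons (ld al) M),
        forall d, d \in al <-> exists x : letter A, d = code_letter x
      & forall w, L w <-> nacc M (cw w)]].

(** The program [p] depends on the three oracle programs but on neither the group nor [c];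
    uniformity rests on this order of quantifiers. *)
Definition oracle_solvable (P : forall (A : finType) (G : groupType),
    (word A -> G) -> (word A -> Prop) -> problem) : Prop :=
  forall rep stal aut, exists p, forall (A : finType) (G : groupType)
    (mu : word A -> G) (L : word A -> Prop) c,
    oracles mu L c rep stal aut -> solves p (with_input c (P A G mu L)).

Lemma code_wordsE (A : finType) (hs : seq (word A)) :
  code_words hs = ld (map (@code_word A) hs).
Proof. exact: code_seqE. Qed.

Lemma stops_domain P p i : solves p P -> valid i -> stops p (code_instance i) ->
  domain (p := P) i.
Proof. by move=> pP vi st; apply: NNPP => nd; case: (pP i vi) => _ /(_ nd). Qed.

Lemma solvesI (P : problem) p :
  (forall i : instance P, valid i -> domain i -> exists2 o : output P,
     answer i o & eval p (code_instance i) (code_output o)) ->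
  (forall i : instance P, valid i -> stops p (code_instance i) -> domain i) ->
  solves p P.
Proof.
move=> h1 h2 i vi; split=> [/(h1 i vi) [o ? ?]|nd /(h2 i vi) //]; by exists o.
Qed.

Section Representatives.
Variables (A : finType) (G : groupType) (mu : word A -> G) (L : word A -> Prop).
Variables (c : data) (rep stal aut : program).
Hypothesis O : oracles mu L c rep stal aut.

(** By [eval_det] this is the output of [rep] wherever there is one; as a function it can be mapped
    over lists of inputs. *)
Definition repf (d : data) : data := epsilon (inhabits Nil) (eval rep d).

Lemma repP u : reduced u -> exists w, [/\ L w, mu w = mu u,
  repf (Cons c (code_word u)) = ld (cw w) &
  eval rep (Cons c (code_word u)) (repf (Cons c (code_word u)))].
Proof.
move=> ru; have [_ /(_ u ru) [w [Lw ew e]] _ _] := O.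
have e' : eval rep (Cons c (code_word u)) (repf (Cons c (code_word u))).
  by apply: (epsilon_spec (inhabits Nil) (eval rep _)); exists (code_word w).
by exists w; rewrite -code_wordE; split=> //; apply: eval_det e' e.
Qed.

Lemma stal_domain hs : all (@reduced A) hs ->
  quasi_convex mu L (generated mu hs) -> exists2 N,
    forall w, L w -> (nacc N (cw w) <-> generated mu hs (mu w)) &
    eval stal (Cons c (code_words hs)) N.
Proof. by have [_ _ S _] := O => v q; case: (S hs v) => /(_ q) [N [? ?]] _; exists N. Qed.

Lemma stal_stops hs : all (@reduced A) hs ->
  stops stal (Cons c (code_words hs)) -> quasi_convex mu L (generated mu hs).
Proof. by have [_ _ S _] := O => v; apply: (stops_domain S v). Qed.
End Representatives.

(** The recognizer is run on the [L]-representative of the word. Since the program calls [stal] on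
    the generators, it stops only if the subgroup is quasi-convex. *)
Lemma oracle_membership : oracle_solvable membership_problem.
Proof.
move=> rep stal aut.
have [q1 q1P] : cd (fun x => Cons (dhead x) (dhead (dtail x))) by computable.
have [q2 q2P] : cd (fun x => Cons (dhead x) (dtail (dtail x))) by computable.
have [q3 q3P] : cb (fun y => nacc (dhead y) (dl (dtail y))) by computable.
exists (PSeq (PCons (PSeq q1 stal) (PSeq q2 rep)) q3) => A G mu L c O.
apply: solvesI => [[hs h] [/= vhs vh]|[hs h] [/= vhs vh] [y]].
  case/(stal_domain O vhs)=> N NP eN; have [w [Lw ew er e]] := repP O vh.
  exists (nacc N (cw w)); first by rewrite -ew; exact: NP.
  apply: (EvSeq (y := Cons N (ld (cw w)))); last first.
    by have := q3P (Cons N (ld (cw w))); rewrite /= ldK.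
  rewrite -er; constructor; first by apply: EvSeq (q1P _) _; exact: eN.
  by apply: EvSeq (q2P _) _; exact: e.
case/eval_seq=> z /eval_pcons [a [b [/eval_seq [s e e'] _ _]]] _.
by apply: (stal_stops O vhs); exists a; rewrite (eval_det (q1P _) e).
Qed.

Lemma code_words_inputs (A : finType) c (hs : seq (word A)) :
  [seq Cons c h | h <- dl (code_words hs)] =
  [seq Cons c (code_word h) | h <- hs].
Proof. by rewrite code_wordsE ldK -map_comp. Qed.

Lemma generated_sub (A : finType) (G : groupType) (mu : word A -> G) hs
  (H : G -> Prop) : is_subgroup H ->
  (forall g, generated mu hs g -> H g) <-> (forall h, h \in hs -> H (mu h)).
Proof.
move=> sH; split=> h; last by move=> g; apply.
by move=> k khs; apply: h; apply: generated_mem.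
Qed.

(** A subgroup is contained in another one as soon as its generators are, so it is enough to test
    their representatives. *)
Lemma all_accepted (A : finType) (G : groupType) (mu : word A -> G) L c
  rep stal aut (hs ks : seq (word A)) N : oracles mu L c rep stal aut ->
  all (@reduced A) hs ->
  (forall w, L w -> (nacc N (cw w) <-> generated mu ks (mu w))) ->
  all (fun r => nacc N (dl r)) [seq repf rep (Cons c (code_word h)) | h <- hs]
  <-> (forall g, generated mu hs g -> generated mu ks g).
Proof.
move=> O vhs NP; rewrite generated_sub; last exact: generated_subgroup.
rewrite all_map; split=> [/allP h k khs|h].
  have := h k khs; have [w [Lw <- /= -> _]] := repP O (allP vhs _ khs).
  by rewrite ldK => /NP; apply.
apply/allP => k khs /=; have [w [Lw ew -> _]] := repP O (allP vhs _ khs).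
by rewrite ldK; apply/NP; rewrite // ew; apply: h.
Qed.

(** The stage shared by containment and equality. Both calls to [stal] are always made, so that
    stopping forces both subgroups to be quasi-convex. *)
Lemma two_recognizers rep stal : exists p, forall (A : finType)
    (G : groupType) (mu : word A -> G) L c aut (hs ks : seq (word A)),
  oracles mu L c rep stal aut -> all (@reduced A) hs -> all (@reduced A) ks ->
  let x := Cons c (Cons (code_words hs) (code_words ks)) in
  let r s := [seq repf rep (Cons c (code_word h)) | h <- s] in
  (quasi_convex mu L (generated mu hs) -> quasi_convex mu L (generated mu ks) ->
   exists N N', [/\
     forall w, L w -> (nacc N (cw w) <-> generated mu hs (mu w)),
     forall w, L w -> (nacc N' (cw w) <-> generated mu ks (mu w)) &
     eval p x (Cons (Cons N N') (Cons (ld (r hs)) (ld (r ks))))]) /\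
  (stops p x -> quasi_convex mu L (generated mu hs) /\
                quasi_convex mu L (generated mu ks)).
Proof.
have [q1 q1P] : cd (fun x => Cons (dhead x) (dhead (dtail x))) by computable.
have [q2 q2P] : cd (fun x => Cons (dhead x) (dtail (dtail x))) by computable.
have [m mP] := eval_map rep.
have [q qP] : cd (fun x => ld [seq Cons (dhead x) h | h <- dl (dtail x)]) by computable.
pose reps s := PSeq s (PSeq q m).
exists (PCons (PCons (PSeq q1 stal) (PSeq q2 stal)) (PCons (reps q1) (reps q2))).
move=> A G mu L c aut hs ks O vhs vks; split=> [dhs dks|[y]].
  have [N NP eN] := stal_domain O vhs dhs.
  have [N' NP' eN'] := stal_domain O vks dks.
  have em ls : all (@reduced A) ls -> eval (PSeq q m) (Cons c (code_words ls))
      (ld [seq repf rep (Cons c (code_word h)) | h <- ls]).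
    move=> vls; apply: EvSeq (qP _) _; rewrite /= code_words_inputs.
    rewrite (map_comp (repf rep) (fun h => Cons c (code_word h))); apply: mP => _ /mapP [h hls ->].
    by have [w []] := repP O (allP vls _ hls).
  exists N, N'; split=> //; constructor; constructor.
  - by apply: EvSeq (q1P _) _; exact: eN.
  - by apply: EvSeq (q2P _) _; exact: eN'.
  - by apply: EvSeq (q1P _) _; exact: em.
  - by apply: EvSeq (q2P _) _; exact: em.
case/eval_pcons=> a [b [/eval_pcons [a1 [a2 [/eval_seq [s e1 f1] /eval_seq [s' e2 f2] _]]] _ _]].
split.
- by apply: (stal_stops O vhs); exists a1; rewrite (eval_det (q1P _) e1).
- by apply: (stal_stops O vks); exists a2; rewrite (eval_det (q2P _) e2).
Qed.

Lemma oracle_containment : oracle_solvable containment_problem.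
Proof.
move=> rep stal aut; have [p pP] := two_recognizers rep stal.
have [q qP] : cb (fun y => all (fun r => nacc (dtail (dhead y)) (dl r)) (dl (dhead (dtail y)))).
  by computable.
exists (PSeq p q) => A G mu L c O.
apply: solvesI => [[hs ks] [/= vhs vks] [dhs dks]|[hs ks] [/= vhs vks] [y]].
  have [/(_ dhs dks) [N [N' [NP NP' e]]] _] := pP _ _ _ _ _ _ _ _ O vhs vks.
  eexists; last by apply: EvSeq e (qP _).
  by rewrite /= ldK; exact: all_accepted O vhs NP'.
case/eval_seq=> z e _; have [_ d] := pP _ _ _ _ _ _ _ _ O vhs vks.
by apply: d; exists z.
Qed.

Lemma oracle_equality : oracle_solvable equality_problem.
Proof.
move=> rep stal aut; have [p pP] := two_recognizers rep stal.
have [q qP] : cb (fun y =>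
    all (fun r => nacc (dtail (dhead y)) (dl r)) (dl (dhead (dtail y))) &&
    all (fun r => nacc (dhead (dhead y)) (dl r)) (dl (dtail (dtail y)))).
  by computable.
exists (PSeq p q) => A G mu L c O.
apply: solvesI => [[hs ks] [/= vhs vks] [dhs dks]|[hs ks] [/= vhs vks] [y]].
  have [/(_ dhs dks) [N [N' [NP NP' e]]] _] := pP _ _ _ _ _ _ _ _ O vhs vks.
  eexists; last by apply: EvSeq e (qP _).
  rewrite /= !ldK; split=> [/andP [/(all_accepted O vhs NP') h /(all_accepted O vks NP) h']|h].
    by move=> g; split; [apply: h | apply: h'].
  by apply/andP; split; [apply/(all_accepted O vhs NP') | apply/(all_accepted O vks NP)] => g /h.
case/eval_seq=> z e _; have [_ d] := pP _ _ _ _ _ _ _ _ O vhs vks.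
by apply: d; exists z.
Qed.

Definition dle (z k : data) : bool := ~~ nz (foldl (fun a _ => dtail a) z (dl k)).

Lemma dleE s k : dle (ld s) (code_nat k) = (size s <= k).
Proof.
rewrite /dle; elim: k s => [|k IH] s /=; first by case: s.
by case: s => [|x s] //=; rewrite -?IH //; exact: (IH [::]).
Qed.

(** Bounded minimization: the counter is frozen as soon as [P] holds of it, and the list merely
    supplies enough rounds. *)
Lemma least_fold (P : data -> bool) j (s : seq data) :
  (forall i, i < j -> ~~ P (code_nat i)) ->
  (exists2 n, n <= j + size s & P (code_nat n)) ->
  exists k, [/\ foldl (fun k _ => if P k then k else Cons Nil k) (code_nat j) s = code_nat k,
    P (code_nat k) & forall i, P (code_nat i) -> k <= i].
Proof.
elim: s j => [|y s IH] j lj [n nj Pn] /=.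
  have jn : j <= n by rewrite leqNgt; apply/negP => /lj; rewrite Pn.
  rewrite addn0 in nj; have E : n = j by apply/eqP; rewrite eqn_leq nj.
  subst n; exists j; split=> // i Pi; rewrite leqNgt; apply/negP => /lj.
  by rewrite Pi.
case: (boolP (P (code_nat j))) => Pj.
  by apply: IH => //; exists j; rewrite ?leq_addr.
apply: (IH j.+1); last by exists n => //; rewrite addSnnS.
by move=> i; rewrite ltnS leq_eqVlt => /orP [/eqP -> | /lj].
Qed.

Definition good_pairs (M N : data) (W : seq data) : seq data :=
  [seq p <- flatten [seq [seq Cons u v | v <- W] | u <- W]
     | nacc M (dl (dhead p) ++ dl (dtail p)) && nacc N (dl (dhead p) ++ dl (dtail p))].

(** One row for each split of a word of [L] representing an element of [H]. An item keeps the
    candidate [z] beside the input that asks [rep] for a representative of u z, since the length of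
    [z] is tested afterwards. *)
Definition queries (c M N : data) (W : seq data) : seq data :=
  [seq ld [seq Cons z (Cons c (ld (dreduce (dl (dhead p) ++ dl z)))) | z <- W]
     | p <- good_pairs M N W].

(** Meant for rows in which each query has been replaced by the answer of [rep]: every prefix must
    be led into [H] by some [z] of length at most [k]. *)
Definition covers (N k : data) (rows : seq data) : bool :=
  all (fun row => has (fun e => dle (dhead e) k && nacc N (dl (dtail e))) (dl row)) rows.

Lemma cl_clock f g : cd f -> cd g -> cl (fun x => clock (f x) (g x)).
Proof.
apply: (cd_comp2 (F := fun M N => ld (clock M N))).
by rewrite -/(cl _) /clock /dtrans /ddst; computable.
Qed.

Lemma cl_queries f g h l : cd f -> cd g -> cd h -> cl l ->
  cl (fun x => queries (f x) (g x) (h x) (l x)).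
Proof.
move=> hf hg hh hl; apply: (@cd_ext (fun x => ld (queries (f x) (g x) (h x) (dl (ld (l x)))))).
  by move=> x; rewrite ldK.
apply: (cd_comp2 (F := fun c y => ld (queries c (dhead y) (dhead (dtail y)) (dl (dtail (dtail y)))))
   (g := fun x => Cons (g x) (Cons (h x) (ld (l x))))); [|by computable..].
by rewrite -/(cl _) /queries /good_pairs; computable.
Qed.

Lemma cb_dle f g : cd f -> cd g -> cb (fun x => dle (f x) (g x)).
Proof.
apply: (cd_comp2 (F := fun M N => code_bool (dle M N))).
by rewrite -/(cb _) /dle; computable.
Qed.

#[export] Hint Resolve cl_clock cl_queries cb_dle : comp.

Lemma cb_covers f g l : cd f -> cd g -> cl l -> cb (fun x => covers (f x) (g x) (l x)).
Proof.
move=> hf hg hl; apply: (@cd_ext (fun x => code_bool (covers (f x) (g x) (dl (ld (l x)))))).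
  by move=> x; rewrite ldK.
apply: (cd_comp3 (F := fun N k l => code_bool (covers N k (dl l)))) => //.
by rewrite -/(cb _) /covers; computable.
Qed.

#[export] Hint Resolve cb_covers : comp.

(** The length of the clock is a constant of quasi-convexity by [quasi_convex_clock], so the least
    one is found below it; each value is tested on the short splits of [quasi_convex_short]. *)
Lemma oracle_least_constant : oracle_solvable least_constant_problem.
Proof.
move=> rep stal aut.
pose al x := dl (dhead (dhead (dtail x))); pose M x := dtail (dhead (dtail x)).
pose N x := dtail (dtail x).
have [q qP] : cd (fun x => ld (queries (dhead x) (M x) (N x)
    (dwords (al x) (clock (M x) (N x))))).
  by rewrite /M /N /al; computable.
(* [m] answers the queries of one row, keeping the candidates, and [m'] those of all rows. *)
have [m mP] := eval_map (PCons PHead (PSeq PTail rep)).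
have [m' mP'] := eval_map m.
have [r rP] : cd (fun y => foldl (fun k _ =>
    if covers (N (dhead y)) k (dl (dtail y)) then k else Cons Nil k)
    (code_nat 0) (clock (M (dhead y)) (N (dhead y)))).
  by rewrite /M /N; computable.
exists (PSeq (PCons PHead (PCons (PSeq PHead aut) stal))
   (PSeq (PCons PId (PSeq q m')) r)) => A G mu L c O.
apply: solvesI => [hs /= vhs dhs|hs /= vhs [y]]; last first.
  case/eval_seq=> z /eval_pcons [a [b [_ /eval_pcons [_ [d [_ e _]]] _]]] _.
  by apply: (stal_stops O vhs); exists d.
have [N0 NP eN] := stal_domain O vhs dhs.
have [muP _ _ [al0 [M0 [eA alP LM]]]] := O.
set H := generated mu hs; have sH : is_subgroup H by apply: generated_subgroup.
pose W := dwords al0 (clock M0 N0).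
pose f e := Cons (dhead e) (repf rep (dtail e)).
pose rows := [seq ld (map f (dl row)) | row <- queries c M0 N0 W].
have WP d : d \in W <-> exists2 w : word A, d = ld (cw w) & size w <= size (clock M0 N0).
  rewrite /W mem_dwords; split=> [/andP [/(all_alphabet alP) [w e] s]|[w -> s]].
    by exists w; rewrite -?e ?dlK //; rewrite e size_map in s.
  by rewrite ldK size_map s andbT; apply/(all_alphabet alP); exists w.
(* The candidates [z] are taken from [W] and are thus no longer than the clock, whence the
   restriction on [k]. *)
have coversP k : k <= size (clock M0 N0) ->
    covers N0 (code_nat k) rows <-> quasi_convex_with mu L H k.
  move=> kc; rewrite (quasi_convex_short muP sH alP LM NP) /covers /rows all_map.
  split=> [/allP cov u v su sv Luv Huv|qc].
    have /cov : ld [seq Cons z (Cons c (ld (dreduce (dl (ld (cw u)) ++ dl z)))) | z <- W]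
        \in queries c M0 N0 W.
      apply/mapP; exists (Cons (ld (cw u)) (ld (cw v))) => //.
      rewrite mem_filter /= !ldK -cw_cat; apply/andP; split.
        by apply/andP; split; [apply/LM | apply/NP].
      by apply/flatten_mapP; exists (ld (cw u)); [|apply: map_f]; apply/WP; eexists.
    rewrite /= !ldK => /hasP [_ /mapP [_ /mapP [d /WP [z -> sz] ->] ->]] /=.
    rewrite dleE ldK -cw_cat size_map => /andP [zk].
    have [w' [rw' ew' ->]] := dreduce_word muP (u ++ z).
    rewrite -code_wordE; have [w [Lw ew -> _]] := repP O rw'.
    by rewrite ldK => /(NP _ Lw); rewrite ew ew' (mu_cat muP); exists z.
  apply/allP => row /mapP [p]; rewrite mem_filter => /andP [/andP [Mp Np]].
  case/flatten_mapP=> _ /WP [u -> su] /mapP [_ /WP [v -> sv] ep] ->.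
  subst p; move: Mp Np; rewrite /= !ldK -cw_cat => /LM Luv /(NP _ Luv) Huv.
  have [z zk Hz] := qc u v su sv Luv Huv.
  apply/hasP; exists (f (Cons (ld (cw z)) (Cons c (ld (dreduce (cw u ++ dl (ld (cw z)))))))).
    do 2!apply: map_f; apply/WP; exists z => //; exact: leq_trans zk kc.
  rewrite /= dleE size_map zk ldK -cw_cat.
  have [w' [rw' ew' ->]] := dreduce_word muP (u ++ z).
  rewrite -code_wordE; have [w [Lw ew -> _]] := repP O rw'.
  by rewrite ldK; apply/(NP _ Lw); rewrite ew ew' (mu_cat muP).
have qcc := quasi_convex_clock muP alP LM NP.
have [||k [fk ck kmin]] := @least_fold (covers N0 ^~ rows) 0 (clock M0 N0).
- by [].
- by exists (size (clock M0 N0)) => //; apply/coversP.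
have kc : k <= size (clock M0 N0) by apply: kmin; apply/coversP.
exists k; first split; first by apply/(coversP k).
  move=> k' qk'; have [k'c|k'c] := leqP k' (size (clock M0 N0)).
    by apply: kmin; apply/coversP.
  by apply: leq_trans kc _; apply: ltnW.
apply: (EvSeq (y := Cons c (Cons (Cons (ld al0) M0) N0))).
  by do !(constructor || exact: eA || exact: eN || apply: EvSeq).
apply: (EvSeq (y := Cons (Cons c (Cons (Cons (ld al0) M0) N0)) (ld rows))).
  constructor; first by constructor.
  apply: EvSeq (qP _) _; rewrite /al /M /N /= ldK -/W; apply: mP' => row.
  case/mapP=> p; rewrite mem_filter => /andP [_ /flatten_mapP [_ /WP [u -> _] /mapP [v _ ->]]] ->.
  rewrite ldK; apply: mP => _ /mapP [_ /WP [z -> _] ->].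
  constructor; first by constructor.
  apply: EvSeq; first by constructor.
  rewrite /= !ldK -cw_cat; have [w' [rw' _ ->]] := dreduce_word muP (u ++ z).
  by rewrite -code_wordE; have [w []] := repP O rw'.
by have := rP (Cons (Cons c (Cons (Cons (ld al0) M0) N0)) (ld rows)); rewrite /M /N /= ldK fk.
Qed.

(** * Stallings-like graphs as recognizers *)

(** Each edge gives a transition in either direction: appending [Nil] to the code of a generator
    gives the code of the letter, and appending [Cons Nil Nil] that of its inverse. *)
Definition graph_nfa (g : data) : data :=
  let b := Cons (dhead g) Nil in
  Cons b (Cons b (ld (flatten
    [seq [:: Cons (Cons (dsrc e) (Cons (dlab e) Nil)) (ddst e);
             Cons (Cons (ddst e) (Cons (dlab e) (Cons Nil Nil))) (dsrc e)]
       | e <- dl (dtail (dtail g))]))).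

Lemma cd_graph_nfa f : cd f -> cd (fun x => graph_nfa (f x)).
Proof.
by move=> hf; apply: (cd_comp hf); rewrite /graph_nfa /dsrc /dlab /ddst /=; computable.
Qed.

#[export] Hint Resolve cd_graph_nfa : comp.

Section Graph.
Variables (A : finType) (Gamma : rooted_graph A).
Let N := graph_nfa (code_rooted_graph Gamma).

Lemma graph_trans t : t \in dtrans N <-> exists p (x : letter A) q,
  step Gamma p x q /\ t = Cons (Cons (code_nat p) (code_letter x)) (code_nat q).
Proof.
rewrite /N /dtrans /= ldK dl_code_seq; split.
  case/flatten_mapP=> _ /mapP [[[p a] q] eE ->]; rewrite !inE => /orP [] /eqP ->.
    by exists p, (a, false), q.
  by exists q, (a, true), p.
case=> p [[a b] [q [e ->]]]; apply/flatten_mapP.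
exists (code_pair (code_pair code_nat (@code_gen A)) code_nat (if b then (q, a, p) else (p, a, q))).
  by apply: map_f; case: b e.
by case: b e => _; rewrite !inE eqxx ?orbT.
Qed.

Lemma graph_run p w dq : drun (dtrans N) (code_nat p) (cw w) dq <->
  exists2 q, dq = code_nat q & walk Gamma p w q.
Proof.
elim: w p => [|x w IH] p /=.
  by split=> [<-|[q -> ->]] //; exists p.
split=> [[t [/graph_trans [p' [x' [r [s ->]]]] /code_nat_inj ep]]|[q eq [r s h]]].
  move=> /code_letter_inj ex /IH [q -> h]; exists q => //; exists r => //.
  by rewrite -ep -ex.
exists (Cons (Cons (code_nat p) (code_letter x)) (code_nat r)); split=> //.
  by apply/graph_trans; exists p, x, r.
by apply: (proj2 (IH r)); exists q.
Qed.

Lemma graph_acc w :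
  nacc N (cw w) <-> walk Gamma (base Gamma) w (base Gamma).
Proof.
rewrite naccP /dinit /dfinal /=; split.
  case=> p [q []]; rewrite !inE => /eqP -> /eqP -> /graph_run [q' /code_nat_inj <-] //.
move=> h; exists (code_nat (base Gamma)), (code_nat (base Gamma)).
by split; rewrite ?inE //; apply/graph_run; exists (base Gamma).
Qed.
End Graph.

Lemma stallings_recognizes (A : finType) (G : groupType) (mu : word A -> G) L H
  Gamma : stallings_like mu L H Gamma -> forall w, L w ->
  (nacc (graph_nfa (code_rooted_graph Gamma)) (cw w) <-> H (mu w)).
Proof. by case=> _ h1 h2 w Lw; rewrite graph_acc; split; auto. Qed.

Lemma alphabetP (A : finType) d :
  d \in [seq code_letter x | x <- enum {: letter A}] <-> exists x : letter A, d = code_letter x.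
Proof.
split=> [/mapP [x _ ->]|[x ->]]; first by exists x.
by apply: map_f; rewrite mem_enum.
Qed.

Lemma solvable_fixed_input c P : solvable (with_input c P) -> solvable P.
Proof.
case=> p pP; have [q qP] : cd (Cons c) by apply: cd_cons; computable.
exists (PSeq q p) => i vi; have [h1 h2] := pP i vi; split=> [/h1 [o [ao e]]|/h2 ns [y]].
  by exists o; split=> //; apply: EvSeq (qP _) e.
by case/eval_seq=> z /(eval_det (qP _)) <- e; apply: ns; exists y.
Qed.

(** For a fixed structure, the alphabet and an automaton of [L] are constants of the program [aut],
    and the additional input is the dummy [Nil]. *)
Lemma rational_oracles (A : finType) (G : groupType) (mu : word A -> G) L :
  algorithmic_structure mu L -> exists rep stal aut, oracles mu L Nil rep stal aut.
Proof.
case=> muP [[M LM] _ _] [p pP] [q qP].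
have [r rP] : cd graph_nfa by apply: cd_graph_nfa; computable.
have [s sP] : cd (fun _ => Cons (ld [seq code_letter x | x <- enum {: letter A}])
    (code_automaton (@code_letter A) M)) by computable.
exists (PSeq PTail p), (PSeq PTail (PSeq q r)), s; split=> //.
- move=> u /pP [w [Lw ew e]]; exists w; split=> //.
  by apply: EvSeq e; constructor.
- apply: solvesI => hs /= vhs.
    case/(proj1 (qP hs vhs)) => Gamma [aG e].
    have GP := stallings_recognizes (aG : stallings_like mu L (generated mu hs) Gamma).
    exists (graph_nfa (code_rooted_graph Gamma)) => //.
    by apply: EvSeq (EvSeq e (rP _)); constructor.
  case=> y /eval_seq [z /(eval_det (EvTail _ _)) <- /eval_seq [t e _]].
  by apply: (stops_domain qP vhs); exists t.
- exists [seq code_letter x | x <- enum {: letter A}], (code_automaton (@code_letter A) M).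
  split; [exact: sP | exact: alphabetP|].
  move=> w; rewrite LM nacc_code; split=> [aw|[z /cw_inj -> //]].
  by exists w.
Qed.

Lemma fixed_structure P (A : finType) (G : groupType) (mu : word A -> G) L :
  oracle_solvable P -> algorithmic_structure mu L -> solvable (P A G mu L).
Proof.
move=> oP /rational_oracles [rep [stal [aut O]]]; have [p pP] := oP rep stal aut.
by apply: (@solvable_fixed_input Nil); exists p; apply: pP.
Qed.

(** * Certificates over an automatic structure *)

Definition unopt (s : seq data) : seq data := [seq dtail o | o <- s & nz o].
Definition unpad1 (z : seq data) : seq data := unopt (map dhead z).
Definition unpad2 (z : seq data) : seq data := unopt (map dtail z).

Lemma cl_unopt l : cl l -> cl (fun x => unopt (l x)).
Proof. by move=> hl; rewrite /unopt; computable. Qed.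

#[export] Hint Resolve cl_unopt : comp.

Lemma cl_unpad1 l : cl l -> cl (fun x => unpad1 (l x)).
Proof. by move=> hl; rewrite /unpad1; computable. Qed.

Lemma cl_unpad2 l : cl l -> cl (fun x => unpad2 (l x)).
Proof. by move=> hl; rewrite /unpad2; computable. Qed.

#[export] Hint Resolve cl_unpad1 cl_unpad2 : comp.

Definition dlookup (k : data) (s : seq data) : data :=
  dtail (dfind (fun e => dhead e == k) s).

Lemma cd_dlookup f l : cd f -> cl l -> cd (fun x => dlookup (f x) (l x)).
Proof.
move=> hf hl; apply: (@cd_ext (fun x => dlookup (f x) (dl (ld (l x))))).
  by move=> x; rewrite ldK.
apply: (cd_comp2 (F := fun k s => dlookup k (dl s))) => //.
by rewrite /dlookup; computable.
Qed.

#[export] Hint Resolve cd_dlookup : comp.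

Lemma dlookup_map (X : eqType) (f g : X -> data) s x : injective f -> x \in s ->
  dlookup (f x) [seq Cons (f y) (g y) | y <- s] = g x.
Proof.
move=> fI; elim: s => //= y s IH; rewrite inE (eq_sym x) /dlookup /= (inj_eq fI).
by case: eqP => [->|_] //; apply: IH.
Qed.

Definition dmult (c o : data) : data := dlookup o (dl (dtail c)).

Lemma cd_dmult f g : cd f -> cd g -> cd (fun x => dmult (f x) (g x)).
Proof. by move=> hf hg; rewrite /dmult; computable. Qed.

#[export] Hint Resolve cd_dmult : comp.

(* Threads a current value through the items: [ok cur e] tests an item against
   it and [nx e] is its new value; [Cons Nil y] means success with last value
   y, and [Nil] failure. *)
Definition dchain (ok : data -> data -> bool) (nx : data -> data) (cur : data)
  (s : seq data) : data :=
  foldl (fun st e => if nz st && ok (dtail st) e then Cons Nil (nx e) else Nil)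
    (Cons Nil cur) s.

Lemma dchain_cons ok nx cur e s :
  dchain ok nx cur (e :: s) = if ok cur e then dchain ok nx (nx e) s else Nil.
Proof. by rewrite /dchain /=; case: ifP => // _; elim: s. Qed.

Lemma cd_dchain (ok : data -> data -> data -> bool) (nx : data -> data) f l :
  cb (fun y => ok (dhead y) (dhead (dtail y)) (dtail (dtail y))) ->
  cd nx -> cd f -> cl l -> cd (fun x => dchain (ok x) nx (f x) (l x)).
Proof.
move=> hok hnx hf hl.
apply: (cd_foldl (F := fun x st e =>
  if nz st && ok x (dtail st) e then Cons Nil (nx e) else Nil));
  [|by computable..].
apply: cd_if; last by computable.
  apply: cb_and; first by computable.
  by apply: (cd_comp (f := fun y => Cons (dhead y)
    (Cons (dtail (dhead (dtail y))) (dtail (dtail y)))) _ hok); computable.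
apply: cd_cons; first by computable.
by apply: (cd_comp (f := fun y => dtail (dtail y)) _ hnx); computable.
Qed.

Definition dsome (x : data) : data := Cons Nil x.

(* In a chain of items [Cons a z] certifying that a word is trivial in G, [z]
   is a padded pair accepted by the multiplier automaton of [a], whose first
   word is the second word of the previous item. *)
Definition mult_ok (c cur e : data) : bool :=
  nacc (dmult c (dhead e)) (dl (dtail e)) && (ld (unpad1 (dl (dtail e))) == cur).

Definition mult_next (e : data) : data := ld (unpad2 (dl (dtail e))).

(** [d] consists of a starting word u and a chain along the letters of [w] that returns to u; for
    nonempty [w] this gives mu u * mu w = mu u. *)
Definition trivial_cert (c : data) (w : seq data) (d : data) : bool :=
  (ld (map dhead (dl (dtail d))) == ld (map dsome w)) &&
  (dchain (mult_ok c) mult_next (dhead d) (dl (dtail d)) == Cons Nil (dhead d)).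

Lemma cb_trivial_cert f g l : cd f -> cl l -> cd g ->
  cb (fun x => trivial_cert (f x) (l x) (g x)).
Proof.
move=> hf hl hg; apply: (@cd_ext (fun x => code_bool (trivial_cert (f x) (dl (ld (l x))) (g x)))).
  by move=> x; rewrite ldK.
apply: (cd_comp3 (F := fun c w d => code_bool (trivial_cert c (dl w) d))) => //.
rewrite -/(cb _) /trivial_cert /dsome; apply: cb_and; first by computable.
apply: cb_eq; last by computable.
apply: (cd_dchain (ok := fun x => mult_ok (dhead x))); [|rewrite /mult_next; by computable..].
by rewrite /mult_ok; computable.
Qed.

#[export] Hint Resolve cb_trivial_cert : comp.

(** [d] lists generators and inverses of generators whose product is the inverse of [w], followed by
    a certificate that [w] times this product is trivial. *)
Definition member_cert (c hs : data) (w : seq data) (d : data) : bool :=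
  all (fun g => g \in dl hs ++ [seq ld (dinv (dl h)) | h <- dl hs]) (dl (dhead d)) &&
  trivial_cert c (w ++ flatten (map dl (dl (dhead d)))) (dtail d).

Lemma cb_member_cert f g h l : cd f -> cd g -> cl l -> cd h ->
  cb (fun x => member_cert (f x) (g x) (l x) (h x)).
Proof.
move=> hf hg hl hh.
apply: (@cd_ext (fun x => code_bool (member_cert (f x) (g x) (dl (ld (l x))) (h x)))).
  by move=> x; rewrite ldK.
apply: (cd_comp2 (F := fun c y =>
     code_bool (member_cert c (dhead y) (dl (dhead (dtail y))) (dtail (dtail y))))
   (g := fun x => Cons (g x) (Cons (ld (l x)) (h x)))); [|by computable..].
by rewrite -/(cb _) /member_cert; computable.
Qed.

#[export] Hint Resolve cb_member_cert : comp.

Section Certificates.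
Variables (A : finType) (G : groupType) (mu : word A -> G) (L : word A -> Prop).
Variable S : automata A.
Hypothesis muP : respecting_epimorphism mu.
Hypothesis SP : automatic_structure mu L S.
Let c := code_automata S.
Local Open Scope group_scope.

Definition copt : option (letter A) -> data := code_option (@code_letter A).
Definition cpad (z : seq (padded_letter A)) : seq data :=
  map (code_pair copt copt) z.

Lemma copt_inj : injective copt.
Proof. by move=> [x|] [y|] // /(congr1 dtail) /code_letter_inj ->. Qed.

Lemma word_automatonP s :
  nacc (dhead c) s <-> exists2 w, s = cw w & L w.
Proof.
have [LM _ _ _] := SP; rewrite nacc_code.
by split=> -[w -> h]; exists w => //; apply/LM.
Qed.

Lemma Lcw w : L w <-> nacc (dhead c) (cw w).
Proof.
rewrite word_automatonP; split=> [h|[v /cw_inj -> //]]; by exists w.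
Qed.

Lemma Lrep g : exists2 w, L w & mu w = g.
Proof. by have [_ _ h _] := SP. Qed.

Lemma unopt_pad n (w : word A) : unopt (map copt (pad n w)) = cw w.
Proof.
rewrite /unopt /pad map_cat filter_cat map_cat map_nseq.
have -> : [seq o <- nseq (n - size w) (copt None) | nz o] = [::] by elim: (n - size w).
by rewrite cats0; elim: w => //= x w ->.
Qed.

Lemma unzip_padded (u v : word A) : exists n,
  [/\ map dhead (cpad (padded_pair u v)) = map copt (pad n u),
      map dtail (cpad (padded_pair u v)) = map copt (pad n v) &
      size v <= n].
Proof.
exists (maxn (size u) (size v)); rewrite leq_maxr /cpad /padded_pair.
have szp (w : word A) n : size w <= n -> size (pad n w) = n.
  by move=> h; rewrite size_cat size_map size_nseq subnKC.
set p := pad _ u; set q := pad _ v.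
have spq : size p = size q by rewrite !szp ?leq_maxr ?leq_maxl.
split=> //; rewrite -!map_comp.
  by rewrite -[in RHS](@unzip1_zip _ _ p q) ?spq // -map_comp; apply: eq_map.
by rewrite -[in RHS](@unzip2_zip _ _ p q) ?spq // -map_comp; apply: eq_map.
Qed.

Lemma unpad1_padded u v : unpad1 (cpad (padded_pair u v)) = cw u.
Proof. by rewrite /unpad1; have [n [-> _ _]] := unzip_padded u v; apply: unopt_pad. Qed.

Lemma unpad2_padded u v : unpad2 (cpad (padded_pair u v)) = cw v.
Proof. by rewrite /unpad2; have [n [_ -> _]] := unzip_padded u v; apply: unopt_pad. Qed.

Lemma dmult_code a : dmult c (copt a) = code_automaton (code_pair copt copt) (multiplier S a).
Proof.
rewrite /dmult /c /= dl_code_seq -/copt.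
apply: (@dlookup_map _ copt
  (fun a => code_automaton (code_pair copt copt) (multiplier S a)) _ _ copt_inj).
by rewrite mem_enum.
Qed.

Lemma dmultP a dz : nacc (dmult c (copt a)) dz <-> exists u v,
  [/\ L u, L v, mu u * mu (seq_of_opt a) = mu v & dz = cpad (padded_pair u v)].
Proof.
have [_ _ _ MP] := SP; rewrite dmult_code nacc_code; split.
  case=> z -> /MP [u [v [Lu Lv e ->]]]; exists u, v; split=> //.
  by rewrite -(mu_cat muP).
case=> u [v [Lu Lv e ->]]; exists (padded_pair u v) => //; apply/MP.
by exists u, v; rewrite (mu_cat muP).
Qed.

(** A key missing from the table is looked up as [Nil], an automaton without initial states, which
    accepts nothing. *)
Lemma dmult_letter o dz : nacc (dmult c o) dz -> exists a, o = copt a.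
Proof.
move=> h; apply: NNPP => no; move: h.
suff -> : dmult c o = Nil by rewrite naccP => -[p [q []]].
rewrite /dmult /c /= dl_code_seq /dlookup; elim: (enum _) => //= a s IH.
by case: eqP => // e; case: no; exists a.
Qed.

(** The first alternative is the empty chain, which does not even ensure that [cur] codes a word. *)
Lemma mult_chain_sound s w cur y : map dhead s = map dsome w ->
  dchain (mult_ok c) mult_next cur s = Cons Nil y ->
  w = [::] /\ cur = y \/ exists w' u v,
  [/\ w = cw w', cur = ld (cw u), y = ld (cw v) & mu u * mu w' = mu v].
Proof.
elim: s w cur => [|e s IH] [|x w] cur //=.
  by move=> _ [->]; left.
case=> hx hw; rewrite dchain_cons; case: ifP => // /andP [ok /eqP <-] /(IH _ _ hw) nx.
right; have [a ea] := dmult_letter ok; move: ok; rewrite ea.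
case/dmultP=> u [v [_ _ euv edz]]; move: ea; rewrite hx.
case: a euv => [x'|] // euv [ex]; rewrite ex.
move: nx; rewrite /mult_next edz unpad1_padded unpad2_padded.
case=> [[-> <-]|[w' [u' [v' [-> /(can_inj ldK) /cw_inj <- -> e']]]]].
  by exists [:: x'], u, v.
exists (x' :: w'), u, v'; split=> //.
by rewrite (mu_cons muP) mulgA euv e'.
Qed.

Lemma trivial_cert_sound s d :
  trivial_cert c s d -> exists2 w, s = cw w & mu w = 1.
Proof.
case/andP=> /eqP /(can_inj ldK) e /eqP /(mult_chain_sound e) [[-> _]|].
  by exists [::] => //; apply: mu_nil.
case=> w [u [v [-> -> /(can_inj ldK) /cw_inj <- ]]] h.
by exists w => //; apply: (mulgI (mu u)); rewrite mulg1.
Qed.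

(** The chain runs through [L]-representatives of the partial products. Its last step has to end at
    [v] itself rather than at another representative, which explains the proviso for empty [w]. *)
Lemma mult_chain_complete w u v : L u -> L v -> mu u * mu w = mu v ->
  (w = [::] -> u = v) -> exists2 s, map dhead s = map dsome (cw w) &
  dchain (mult_ok c) mult_next (ld (cw u)) s = Cons Nil (ld (cw v)).
Proof.
elim: w u => [|x w IH] u Lu Lv e.
  by move=> /(_ erefl) ->; exists [::].
move=> _; have [v' [Lv' ev' h]] : exists v',
    [/\ L v', mu u * mu [:: x] = mu v' & (w = [::] -> v' = v)].
  case: w e {IH} => [|y w] e; first by exists v.
  by have [v' Lv' ev'] := Lrep (mu u * mu [:: x]); exists v'.
have [|s hs hc] := IH v' Lv' Lv _ h; first by rewrite -ev' -mulgA -(mu_cons muP).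
exists (Cons (dsome (code_letter x)) (ld (cpad (padded_pair u v'))) :: s).
  by rewrite /= hs.
rewrite dchain_cons /mult_ok /mult_next /= !ldK unpad1_padded unpad2_padded eqxx andbT.
suff -> : nacc (dmult c (dsome (code_letter x))) (cpad (padded_pair u v')) by [].
by apply/(dmultP (Some x)); exists u, v'.
Qed.

Lemma trivial_cert_complete w : mu w = 1 -> exists d, trivial_cert c (cw w) d.
Proof.
move=> e; have [u Lu _] := Lrep 1.
have e' : mu u * mu w = mu u by rewrite e mulg1.
have [s hs hc] := mult_chain_complete Lu Lu e' (fun _ => erefl).
by exists (Cons (ld (cw u)) (ld s)); rewrite /trivial_cert /= ldK hs hc !eqxx.
Qed.

Lemma generated_words hs g : generated mu hs g -> exists2 gs,
  all (mem (hs ++ map (@winv A) hs)) gs & mu (flatten gs) = g.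
Proof.
pose H g := exists2 gs, all (mem (hs ++ map (@winv A) hs)) gs & mu (flatten gs) = g.
move/(_ H); apply=> [|h hhs]; last first.
  by exists [:: h]; rewrite /= ?cats0 ?mem_cat ?hhs.
split; first by exists [::] => //; apply: mu_nil.
  move=> x y [gs gsP <-] [gs' gsP' <-]; exists (gs ++ gs').
    by rewrite all_cat gsP.
  by rewrite flatten_cat (mu_cat muP).
move=> x [gs gsP <-]; exists (rev (map (@winv A) gs)).
  rewrite all_rev all_map; apply: sub_all gsP => g0 /=; rewrite !mem_cat.
  by case/orP=> [/(map_f (@winv A)) ->|/mapP [h hhs ->]]; rewrite ?orbT // winvK hhs.
elim: gs {gsP} => [|g' gs IH] /=; first by rewrite (mu_nil muP) invg1.
by rewrite rev_cons -cats1 flatten_cat (mu_cat muP) IH /= cats0 (mu_inv muP) (mu_cat muP) invgM.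
Qed.

Lemma member_cert_sound hs s d : member_cert c (code_words hs) s d ->
  exists2 w, s = cw w & generated mu hs (mu w).
Proof.
case/andP=> gsP /trivial_cert_sound [W /esym eW muW].
have [w [v [eW' -> ev]]] := cw_split eW; exists w => //.
have [_ HM HV] := generated_subgroup mu hs.
suff Hv : generated mu hs (mu v).
  have -> : mu w = (mu v)^-1 by apply: (mulIg (mu v)); rewrite mulVg -(mu_cat muP) -eW'.
  exact: HV.
move: gsP ev; rewrite code_wordsE ldK; elim: (dl _) v {W eW muW eW'} => [|g gs IH] v.
  by case: v => // _ _; rewrite (mu_nil muP); case: (generated_subgroup mu hs).
case/andP=> gP gsP /= /esym ev; have [v1 [v2 [-> eg ev2]]] := cw_split ev.
rewrite (mu_cat muP); apply: HM _ (IH _ gsP ev2).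
move: gP; rewrite mem_cat => /orP [/mapP [h hhs]|/mapP [_ /mapP [h hhs ->]]] e.
  move: eg; rewrite e code_wordE ldK => /cw_inj <-; exact: generated_mem.
move: eg; rewrite e code_wordE !ldK -cw_inv => /cw_inj <-.
by rewrite (mu_inv muP); apply: HV; apply: generated_mem.
Qed.

Lemma member_cert_complete hs w : generated mu hs (mu w) ->
  exists d, member_cert c (code_words hs) (cw w) d.
Proof.
have [_ _ HV] := generated_subgroup mu hs.
move=> /HV /generated_words [gs gsP e].
have [|d dP] := trivial_cert_complete (w := w ++ flatten gs).
  by rewrite (mu_cat muP) e mulgV.
exists (Cons (ld (map (@code_word A) gs)) d); apply/andP; rewrite /= ldK; split.
  rewrite all_map; apply: sub_all gsP => g /=; rewrite !mem_cat code_wordsE ldK.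
  case/orP=> [/(map_f (@code_word A)) ->//|/mapP [h hhs ->]].
  apply/orP; right; apply/mapP; exists (code_word h); first exact: map_f.
  by rewrite !code_wordE ldK cw_inv.
suff -> : flatten [seq dl i | i <- [seq code_word i | i <- gs]] = cw (flatten gs) by rewrite -cw_cat.
rewrite -map_comp /cw map_flatten; congr flatten; apply: eq_map => g /=.
by rewrite code_wordE ldK.
Qed.
End Certificates.

(** The search is for a word w of [L] together with a certificate that w^-1 u is trivial;
    surjectivity of [mu] on [L] ensures success. *)
Lemma automatic_representatives : exists p, forall (A : finType) (G : groupType)
    (mu : word A -> G) (L : word A -> Prop) (S : automata A),
  respecting_epimorphism mu -> automatic_structure mu L S -> forall u,
  exists w : word A, [/\ L w, mu w = mu u &
    eval p (Cons (code_automata S) (code_word u)) (code_word w)].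
Proof.
pose P x d := nacc (dhead (dhead x)) (dl (dhead d)) &&
  trivial_cert (dhead x) (dinv (dl (dhead d)) ++ dl (dtail x)) (dtail d).
have [|p pP] := search (P := P); first by rewrite /P; computable.
exists (PSeq p PHead) => A G mu L S muP SP u.
have [h _] := pP (Cons (code_automata S) (code_word u)).
have [|d Pd e] := h.
  have [w Lw ew] := Lrep SP (mu u).
  have [|d dP] := trivial_cert_complete muP SP (w := winv w ++ u).
    by rewrite (mu_cat muP) (mu_inv muP) ew mulVg.
  exists (Cons (ld (cw w)) d); rewrite /P /= code_wordE !ldK -cw_inv -cw_cat dP andbT.
  exact/(Lcw SP).
case/andP: Pd => /(word_automatonP SP) [w ew Lw].
rewrite ew /= code_wordE ldK -cw_inv -cw_cat -code_wordE.
case/(trivial_cert_sound muP SP)=> v /cw_inj <-; rewrite (mu_cat muP) (mu_inv muP) => ev.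
exists w; split=> //; first by apply: (mulgI (mu w)^-1%g); rewrite ev mulVg.
by apply: EvSeq e _; rewrite [code_word w]code_wordE -ew dlK; case: (d); constructor.
Qed.

(** * Certificates for recognizers of subgroups *)

Definition pstep (K S o : data) : data := if nz o then dstep K S (dtail o) else S.

Lemma cd_pstep f g h :
  cd f -> cd g -> cd h -> cd (fun x => pstep (f x) (g x) (h x)).
Proof. by move=> hf hg hh; rewrite /pstep; computable. Qed.

#[export] Hint Resolve cd_pstep : comp.

Lemma foldl_pstep K S s : foldl (pstep K) S s = foldl (dstep K) S (unopt s).
Proof. by elim: s S => //= o s IH S; rewrite IH /pstep /unopt /=; case: ifP. Qed.

(* An item [Cons a (Cons K' R)] after the automaton K: the set R of triples
   (m, S, S') contains all those reached by reading a padded pair (u, v), where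
   m is a state of the multiplier automaton of [a] and S, S' are the sets of
   states of K, K' reached by u, v; whenever m is final, K accepts u if and only
   if K' accepts v. *)
Definition rel_ok (c K e : data) : bool :=
  let M := dmult c (dhead e) in
  let K' := dhead (dtail e) in
  let R := dl (dtail (dtail e)) in
  [&& all (fun i => Cons i (Cons (dhead K) (dhead K')) \in R) (dinit M),
      all (fun r => all (fun t => (dsrc t == dhead r) ==>
        (Cons (ddst t) (Cons (pstep K (dhead (dtail r)) (dhead (dlab t)))
                             (pstep K' (dtail (dtail r)) (dtail (dlab t)))) \in R))
        (dtrans M)) R
    & all (fun r => (dhead r \in dfinal M) ==>
        (daccept K (dhead (dtail r)) == daccept K' (dtail (dtail r)))) R].

Definition rel_next (e : data) : data := dhead (dtail e).

(** A chain of automata from [N] back to [N]: it shows that acceptance by [N] is invariant under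
    right multiplication by the element that [h] spells. *)
Definition chain_cert (c N h d : data) : bool :=
  (ld (map dhead (dl d)) == h) &&
  (dchain (rel_ok c) rel_next N (dl d) == Cons Nil N).

Lemma cb_chain_cert f g h k : cd f -> cd g -> cd h -> cd k ->
  cb (fun x => chain_cert (f x) (g x) (h x) (k x)).
Proof.
move=> hf hg hh hk.
apply: (cd_comp2 (F := fun c y =>
     code_bool (chain_cert c (dhead y) (dhead (dtail y)) (dtail (dtail y))))
   (g := fun x => Cons (g x) (Cons (h x) (k x)))); [|by computable..].
rewrite -/(cb _) /chain_cert; apply: cb_and; first by computable.
apply: cb_eq; last by computable.
apply: (cd_dchain (ok := fun x => rel_ok (dhead x))); [|rewrite /rel_next; by computable..].
by rewrite /rel_ok /dinit /dfinal /dtrans /dsrc /dlab /ddst /=; computable.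
Qed.

#[export] Hint Resolve cb_chain_cert : comp.

Definition dlabel (lam s : data) : seq data := dl (dlookup s (dl lam)).

Definition to_certify (N lam : data) : seq data :=
  [seq ld (dlabel lam s) | s <- dinit N ++ dfinal N] ++
  [seq ld (dlabel lam (dsrc t) ++ dlab t :: dinv (dlabel lam (ddst t)))
     | t <- dtrans N].

(* The states s of N are labeled by words that represent the cosets of H: a
   word leading from s to t represents an element of w_s^-1 H w_t. *)
Definition sound_cert (c hs N lam certs : data) : bool :=
  all (fun w => has (member_cert c hs (dl w)) (dl certs)) (to_certify N lam).

(** The components of [d] are N, the labeling of its states, membership certificates, a word v of
    [L] accepted by N, a certificate that v is trivial, and chains. The shape [Cons Nil Nil] is a
    chain with one item, for the multiplier of 1: acceptance depends only on the element
    represented. *)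
Definition recognizer_cert (x d : data) : bool :=
  let c := dhead x in
  let hs := dtail x in
  let N := dhead d in
  let v := dl (dhead (dtail (dtail (dtail d)))) in
  [&& sound_cert c hs N (dhead (dtail d)) (dhead (dtail (dtail d))),
      nacc (dhead c) v, nacc N v,
      trivial_cert c v (dhead (dtail (dtail (dtail (dtail d)))))
    & all (fun h => has (chain_cert c N h) (dl (dtail (dtail (dtail (dtail (dtail d)))))))
        (Cons Nil Nil :: [seq ld (map dsome (dl h)) | h <- dl hs])].

Lemma cb_recognizer_cert : cb (fun y => recognizer_cert (dhead y) (dtail y)).
Proof.
rewrite /recognizer_cert /sound_cert /to_certify /dlabel /dinit /dfinal /dtrans
  /dsrc /dlab /ddst /dsome /=.
by computable.
Qed.

(** Certificates are found by search and only have to exist, so their parts may be selected by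
    undecidable properties. *)
Lemma classical_filter (T : eqType) (P : T -> Prop) (s : seq T) :
  exists s' : seq T, forall x, x \in s' <-> x \in s /\ P x.
Proof.
elim: s => [|y s [s' IH]]; first by exists [::] => x; split=> // -[].
case: (classic (P y)) => Py.
  exists (y :: s') => x; rewrite !inE; split.
    by case/orP=> [/eqP ->|/IH [xs Px]]; rewrite ?eqxx // xs orbT.
  by case=> /orP [->//|xs] Px; apply/orP; right; apply/IH.
exists s' => x; rewrite inE IH; split=> [[-> Px]|[/orP [/eqP ->|xs] Px]] //.
by rewrite orbT.
Qed.

Lemma all_filters (T : eqType) (s : seq T) :
  exists l : seq (seq T), forall P, filter P s \in l.
Proof.
elim: s => [|y s [l IH]]; first by exists [:: [::]] => P; rewrite inE.
exists (l ++ map (cons y) l) => P; rewrite mem_cat /=.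
by case: (P y); rewrite ?IH // (map_f (cons y)) ?orbT.
Qed.

(** A value of [dstep] lists the targets of a sublist of the transitions, and there are finitely
    many sublists. *)
Lemma finite_subsets K : exists l : seq data, dhead K \in l /\
  forall S x, dstep K S x \in l.
Proof.
have [l lP] := all_filters (dtrans K).
exists (dhead K :: [seq ld (map ddst s) | s <- l]); split; first exact: mem_head.
by move=> S x; rewrite inE (map_f (fun s => ld (map ddst s))) ?orbT.
Qed.

Lemma drun_end T p w q : drun T p w q -> q \in p :: map ddst T.
Proof.
elim: w p => [|x w IH] p /=; first by move=> ->; apply: mem_head.
case=> t [tT _ _ /IH]; rewrite !inE => /orP [/eqP ->|->]; rewrite ?orbT //.
by rewrite map_f ?orbT.
Qed.

(* The second words v of the padded pairs (u, v) that M accepts and whose first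
   word u is accepted by K. The states are the pairs of a state of M and a set of
   states of K; the part of u that exceeds v is dealt with by the final states. *)
Section Image.
Variables (M K : data) (l : seq data).
Hypothesis Kl : dhead K \in l.
Hypothesis stepl : forall S x, dstep K S x \in l.

Definition image_trans : seq data :=
  [seq Cons (Cons (Cons (dsrc t) s) (dtail (dtail (dlab t))))
            (Cons (ddst t) (pstep K s (dhead (dlab t))))
     | t <- [seq t <- dtrans M | nz (dtail (dlab t))], s <- l].

Lemma pstep_l S o : S \in l -> pstep K S o \in l.
Proof. by rewrite /pstep; case: ifP. Qed.

Lemma image_run m S w q : S \in l -> drun image_trans (Cons m S) w q <->
  exists m' z, [/\ all (fun e => nz (dtail e)) z, map (fun e => dtail (dtail e)) z = w,
    drun (dtrans M) m z m' & q = Cons m' (foldl (pstep K) S (map dhead z))].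
Proof.
elim: w m S => [|x w IH] m S Sl /=.
  split=> [<-|[m' [z [_ zw zr ->]]]]; first by exists m, [::].
  by case: z zw zr => //= _ ->.
split.
  case=> _ [/allpairsP [[t S'] /= [tT S'l ->]] /= [<- <-] <-].
  move: tT; rewrite mem_filter => /andP [tnz tT].
  move=> /(IH _ _ (pstep_l _ S'l)) [m' [z [znz zw zr ->]]].
  exists m', (dlab t :: z); rewrite /= tnz zw; split=> //.
  by exists t.
case=> m' [z []]; case: z => //= e z /andP [enz znz] [ex ew] [t [tT tm te zr]] eq.
exists (Cons (Cons (Cons (dsrc t) S) (dtail (dtail (dlab t))))
            (Cons (ddst t) (pstep K S (dhead (dlab t))))); split.
- by apply/allpairsP; exists (t, S); rewrite mem_filter te enz tT.
- by rewrite /dsrc /= -/(dsrc t) tm.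
- by rewrite /dlab /= -/(dlab t) te.
apply: (proj2 (IH _ _ (pstep_l _ Sl))).
by exists m', z; rewrite te.
Qed.

Lemma unpad2_nz z : all (fun e => nz (dtail e)) z ->
  unpad2 z = map (fun e => dtail (dtail e)) z.
Proof.
rewrite /unpad2 /unopt; elim: z => //= e z IH /andP [enz znz].
by rewrite enz /= IH.
Qed.

(** [z] is the part of the padded pair along which the second word lasts, and [z'] the rest. The
    final states [F] are those from which some [z'] completes a pair accepted by [M] with first word
    accepted by [K]. *)
Lemma image_automaton : exists K', forall w, nacc K' w <->
  exists z z', [/\ all (fun e => nz (dtail e)) z, all (fun e => ~~ nz (dtail e)) z',
    nacc M (z ++ z'), unpad2 z = w & nacc K (unpad1 (z ++ z'))].
Proof.
pose P q := exists z f, [/\ all (fun e => ~~ nz (dtail e)) z, f \in dfinal M,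
  drun (dtrans M) (dhead q) z f & daccept K (foldl (pstep K) (dtail q) (map dhead z))].
have [F FP] := classical_filter P
  [seq Cons m s | m <- dinit M ++ map ddst (dtrans M), s <- l].
exists (Cons (ld [seq Cons i (dhead K) | i <- dinit M]) (Cons (ld F) (ld image_trans))) => w.
rewrite naccP /dinit /dfinal /dtrans /= !ldK -/(dinit M); split.
  case=> p [q [/mapP [i iM ->] qF /image_run]] /(_ Kl) [m [z [znz zw zr eq]]].
  move: qF; rewrite eq => /FP [_ [z' [f [z'nz fM z'r]]]] /=; rewrite -foldl_cat -map_cat => acc.
  exists z, z'; split=> //; rewrite ?unpad2_nz //.
    by apply/naccP; exists i, f; split=> //; apply/drun_cat; exists m.
  by rewrite /nacc /unpad1 -foldl_pstep.
case=> z [z' [znz z'nz /naccP [i [f [iM fM /drun_cat [m zr z'r]]]] <-]].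
rewrite unpad2_nz // /nacc /unpad1 -foldl_pstep map_cat foldl_cat => acc.
exists (Cons i (dhead K)), (Cons m (foldl (pstep K) (dhead K) (map dhead z))); split.
- exact: map_f.
- apply/FP; split; last by exists z', f.
  apply/allpairsP; exists (m, foldl (pstep K) (dhead K) (map dhead z)); split=> //=.
    by have := drun_end zr; rewrite inE mem_cat => /orP [/eqP ->|->]; rewrite ?iM ?orbT.
  by elim/last_ind: (map dhead z) => //= s o IH; rewrite foldl_rcons; apply: pstep_l.
- by apply/(image_run _ _ _ Kl); exists m, z.
Qed.
End Image.

Section Recognizer.
Variables (A : finType) (G : groupType) (mu : word A -> G) (L : word A -> Prop).
Variable S : automata A.
Hypothesis muP : respecting_epimorphism mu.
Hypothesis SP : automatic_structure mu L S.
Let c := code_automata S.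
Local Open Scope group_scope.
Let opt_word (s : seq (option (letter A))) : word A := flatten (map seq_of_opt s).

Lemma rel_ok_sound K e a u v : rel_ok c K e -> dhead e = copt a ->
  L u -> L v -> mu u * mu (seq_of_opt a) = mu v ->
  nacc K (cw u) = nacc (rel_next e) (cw v).
Proof.
case/and3P=> /allP init /allP closed /allP fin ea Lu Lv euv.
have /naccP : nacc (dmult c (dhead e)) (cpad (padded_pair u v)).
  by rewrite ea; apply/(dmultP muP SP); exists u, v.
case=> i [f [iM fM r]].
(* The triples met along the run of the multiplier automaton stay in the closed set R, by induction
   on the run. *)
suff /fin : Cons f (Cons (foldl (pstep K) (dhead K) (map dhead (cpad (padded_pair u v))))
    (foldl (pstep (rel_next e)) (dhead (rel_next e)) (map dtail (cpad (padded_pair u v)))))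
    \in dl (dtail (dtail e)).
  rewrite /= fM !foldl_pstep => /eqP.
  by rewrite -/(unpad1 _) -/(unpad2 _) unpad1_padded unpad2_padded.
elim: (cpad _) i (dhead K) (dhead (rel_next e)) {iM init}(init _ iM) r => [|x z IH] m s s' msR /=.
  by move=> <-.
case=> t [tM ts tx /IH]; apply; have /allP /(_ t tM) := closed _ msR.
by rewrite /= ts eqxx tx.
Qed.

Lemma chain_sound s opts K y u v : map dhead s = map (@copt A) opts ->
  dchain (rel_ok c) rel_next K s = Cons Nil y -> L u -> L v ->
  mu u * mu (opt_word opts) = mu v -> (opts = [::] -> u = v) ->
  nacc K (cw u) = nacc y (cw v).
Proof.
elim: s opts K u => [|e s IH] [|a opts] K u //=.
  by move=> _ [<-] _ _ _ ->.
case=> ea es; rewrite dchain_cons; case: ifP => // ok ch Lu Lv euv _.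
have [u' [Lu' eu' h]] : exists u',
    [/\ L u', mu u * mu (seq_of_opt a) = mu u' & (opts = [::] -> u' = v)].
  case: opts euv {es} => [|b opts] euv.
    by exists v; rewrite -euv /opt_word /= cats0.
  by have [u' Lu' eu'] := Lrep SP (mu u * mu (seq_of_opt a)); exists u'.
rewrite (rel_ok_sound ok ea Lu Lu' eu'); apply: IH es ch Lu' Lv _ h.
by rewrite -eu' -mulgA -(mu_cat muP).
Qed.

Lemma opt_word_some (h : word A) : opt_word (map Some h) = h.
Proof. by rewrite /opt_word; elim: h => //= x h ->. Qed.

Lemma copt_some (h : word A) : map (@copt A) (map Some h) = map dsome (cw h).
Proof. by rewrite -!map_comp. Qed.

(** The elements whose right multiplication preserves acceptance by [N] form a subgroup that
    contains the generators. Every word of [L] representing an element of it can thus be compared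
    with [v], which represents 1 and is accepted. *)
Lemma chain_certs_sound hs N v : L v -> nacc N (cw v) -> mu v = 1 ->
  (exists ch, chain_cert c N (Cons Nil Nil) ch) ->
  (forall h, h \in hs -> exists ch, chain_cert c N (ld (map dsome (cw h))) ch) ->
  forall w, L w -> generated mu hs (mu w) -> nacc N (cw w).
Proof.
move=> Lv Nv muv [ch0 /andP [/eqP h0 /eqP c0]] chs w Lw Hw.
pose H g := forall u u', L u -> L u' -> mu u * g = mu u' -> nacc N (cw u) = nacc N (cw u').
suff Hg : H (mu w) by rewrite -(Hg v w) // muv mul1g.
apply: Hw; last first.
  move=> h /chs [ch /andP [/eqP /(can_inj ldK) e /eqP hc]] u u' Lu Lu' euu'.
  case: h e euu' => [|x h] e euu'; last first.
    apply: (chain_sound (opts := map Some (x :: h)) _ hc Lu Lu' _ _) => //.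
      by rewrite e -copt_some.
    by rewrite opt_word_some.
  (* The chain of an empty generator is empty and cannot compare two representatives of one element;
     the chain through [None] does. *)
  apply: (chain_sound (s := dl ch0) (opts := [:: None]) _ c0 Lu Lu' _ _) => //.
  by rewrite -(ldK (map _ _)) h0.
have H1 : H 1.
  move=> u u' Lu Lu' euu'; apply: (chain_sound (s := dl ch0) (opts := [:: None]) _ c0 Lu Lu' _ _) => //.
    by rewrite -(ldK (map _ _)) h0.
  by rewrite -euu' /opt_word /= (mu_nil muP).
split=> // [x y hx hy u u' Lu Lu' e|x hx u u' Lu Lu' e].
  have [t Lt et] := Lrep SP (mu u * x).
  by rewrite (hx u t) // (hy t u') // et -mulgA.
by apply/esym; apply: hx => //; rewrite -e mulgVK.
Qed.

(** Along a run the certified products w_p x w_q^-1 telescope, and the labels of the initial and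
    final states lie in the subgroup themselves. *)
Lemma sound_cert_sound hs N lam certs : sound_cert c (code_words hs) N lam certs ->
  forall w, nacc N (cw w) -> generated mu hs (mu w).
Proof.
move=> /allP cert w /naccP [p [q [pN qN r]]].
have certP s : ld s \in to_certify N lam -> exists2 v, s = cw v & generated mu hs (mu v).
  by move=> /cert /hasP [d _]; rewrite ldK => /(member_cert_sound muP SP).
have [_ HM HV] := generated_subgroup mu hs.
have labP s : s \in dinit N ++ dfinal N -> exists2 v, dlabel lam s = cw v & generated mu hs (mu v).
  by move=> sN; apply: certP; rewrite mem_cat (map_f (fun s => ld (dlabel lam s))).
have [Q eQ HQ] : exists2 Q, dlabel lam q = cw Q & generated mu hs (mu Q).
  by apply: labP; rewrite mem_cat qN orbT.
suff [P eP HP] : exists2 P, dlabel lam p = cw P & generated mu hs (mu P * mu w * (mu Q)^-1).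
  have [P' eP' HP'] : exists2 P, dlabel lam p = cw P & generated mu hs (mu P).
    by apply: labP; rewrite mem_cat pN.
  have {eP'} EP : P' = P by apply: (@cw_inj A); rewrite -eP'.
  have -> : mu w = (mu P')^-1 * ((mu P * mu w * (mu Q)^-1) * mu Q).
    by rewrite EP mulgVK mulKg.
  by apply: (HM); [apply: HV | apply: HM].
elim: w p r {pN} => [|x w IH] p /=.
  by move=> ->; exists Q => //; rewrite (mu_nil muP) mulg1 mulgV; case: (generated_subgroup mu hs).
case=> t [tN tp tx /IH [R eR HR]].
have [|V eV HV'] := certP (dlabel lam p ++ code_letter x :: dinv (dlabel lam (ddst t))).
  rewrite mem_cat -tp -tx; apply/orP; right.
  exact: (map_f (fun t =>
    ld (dlabel lam (dsrc t) ++ dlab t :: dinv (dlabel lam (ddst t))))) tN.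
move: eV; rewrite eR -cw_inv -[code_letter x :: cw _]/(cw (x :: winv R)).
move/esym => eV; have [P [V' [eV1 -> eV2]]] := cw_split eV; exists P => //.
move: eV2 => /cw_inj ?; subst V V'; move: HV'.
rewrite (mu_cat muP) (mu_cons muP) (mu_inv muP) => HV'.
have -> : mu P * mu (x :: w) * (mu Q)^-1 =
  (mu P * (mu [:: x] * (mu R)^-1)) * (mu R * mu w * (mu Q)^-1).
  by rewrite (mu_cons muP x w) !mulgA mulgVK.
exact: HM.
Qed.

Lemma recognizer_cert_sound hs d : recognizer_cert (Cons c (code_words hs)) d ->
  forall w, L w -> (nacc (dhead d) (cw w) <-> generated mu hs (mu w)).
Proof.
case/and5P=> /sound_cert_sound snd /(word_automatonP SP) [v ev Lv] Nv.
case/(trivial_cert_sound muP SP)=> v'; rewrite ev => /cw_inj <- muv.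
move: Nv; rewrite ev => Nv /andP [/hasP [ch0 _ h0] /allP chs] w Lw.
split=> [|Hw]; first exact: snd.
apply: (chain_certs_sound Lv Nv muv) Lw Hw; first by exists ch0.
move=> h hhs; have := chs (ld (map dsome (dl (code_word h)))).
rewrite code_wordE ldK => /(_ _)/hasP [|ch _ ?]; last by exists ch.
apply/mapP; exists (code_word h); last by rewrite code_wordE ldK.
by rewrite /= code_wordsE ldK map_f.
Qed.
End Recognizer.

(** * Existence of certificates from a Stallings-like graph *)

Section Completeness.
Variables (A : finType) (G : groupType) (mu : word A -> G) (L : word A -> Prop).
Variable S : automata A.
Hypothesis muP : respecting_epimorphism mu.
Hypothesis SP : automatic_structure mu L S.
Let c := code_automata S.
Local Open Scope group_scope.
Let opt_word (s : seq (option (letter A))) : word A := flatten (map seq_of_opt s).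
Variable H : G -> Prop.

Definition coset_recognizer (g : G) (K : data) : Prop :=
  forall v, L v -> (nacc K (cw v) <-> H (mu v * g^-1)).

(** R is taken to be the set of all reachable triples, finite by [finite_subsets]. At a final state
    the pair read satisfies mu u * a = mu v, so u lies in the coset H g exactly when v lies in H g
    a. *)
Lemma rel_ok_complete g a K K' : coset_recognizer g K ->
  coset_recognizer (g * mu (seq_of_opt a)) K' ->
  exists R, rel_ok c K (Cons (copt a) (Cons K' R)).
Proof.
move=> gK gK'; have [l [Kl stepl]] := finite_subsets K.
have [l' [Kl' stepl']] := finite_subsets K'.
set M := dmult c (copt a).
pose P r := exists z i, [/\ i \in dinit M, drun (dtrans M) i z (dhead r),
  dhead (dtail r) = foldl (pstep K) (dhead K) (map dhead z) &
  dtail (dtail r) = foldl (pstep K') (dhead K') (map dtail z)].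
have [R RP] := classical_filter P
  [seq Cons m x | m <- dinit M ++ map ddst (dtrans M),
     x <- [seq Cons s s' | s <- l, s' <- l']].
exists (ld R); rewrite /rel_ok /= ldK -/M; apply/and3P; split.
- apply/allP => i iM; apply/RP; split; last by exists [::], i.
  apply/allpairsP; exists (i, Cons (dhead K) (dhead K')).
  split=> //=; first by rewrite mem_cat iM.
  by apply/allpairsP; exists (dhead K, dhead K').
- apply/allP => r /RP [/allpairsP [[m x] /= [mM /allpairsP [[s s'] /= [sl sl' ->]] ->]]].
  case=> z [i [/= iM zr es es']]; apply/allP => t tM; apply/implyP => /eqP tm.
  apply/RP; split.
    apply/allpairsP; eexists (_, Cons _ _); split=> /=; last reflexivity.
      by rewrite mem_cat (map_f ddst) ?orbT.
    by apply/allpairsP; exists (pstep K s (dhead (dlab t)), pstep K' s' (dtail (dlab t)));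
      split=> //=; apply: pstep_l.
  exists (z ++ [:: dlab t]), i; split=> //=.
  + by apply/drun_cat; exists m => //=; exists t.
  + by rewrite map_cat foldl_cat -es.
  + by rewrite map_cat foldl_cat -es'.
apply/allP => r /RP [_ [z [i [iM zr es es']]]]; apply/implyP => rM.
have /(dmultP muP SP) [u [v [Lu Lv euv ez]]] : nacc M z.
  by apply/naccP; exists i, (dhead r).
rewrite es es' !foldl_pstep ez -/(unpad1 _) -/(unpad2 _) unpad1_padded unpad2_padded.
apply/eqP; apply/idP/idP; rewrite -/(nacc _ _) -/(nacc _ _).
  by move/(gK _ Lu) => Hu; apply/(gK' _ Lv); rewrite -euv invgM mulgA mulgK.
by move/(gK' _ Lv) => Hv; apply/(gK _ Lu); rewrite -euv invgM mulgA mulgK in Hv.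
Qed.

(** The words of [L] in the coset H g a are the second words of the pairs accepted by the multiplier
    of [a] whose first word lies in H g, so the image automaton recognizes them. *)
Lemma coset_recognizer_step g a K : coset_recognizer g K ->
  exists K', coset_recognizer (g * mu (seq_of_opt a)) K'.
Proof.
move=> gK; have [l [Kl stepl]] := finite_subsets K.
have [K' K'P] := image_automaton (dmult c (copt a)) Kl stepl.
exists K' => v Lv; rewrite K'P; split.
  case=> z [z' [znz z'nz /(dmultP muP SP) [u [v' [Lu Lv' euv ez]]] zv]].
  have ev : v' = v.
    apply: (@cw_inj A); rewrite -zv -(unpad2_padded u) -ez /unpad2 /unopt.
    rewrite map_cat filter_cat map_cat.
    suff -> : [seq o <- map dtail z' | nz o] = [::] by rewrite cats0.
    by elim: z' z'nz {ez} => //= e z' IH /andP [/negbTE -> /IH].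
  rewrite ez unpad1_padded => /(gK _ Lu).
  by rewrite -ev -euv invgM mulgA mulgK.
move=> Hv; have [u Lu eu] := Lrep SP (mu v * (mu (seq_of_opt a))^-1).
pose z := cpad (padded_pair u v); have [n [_ ez vn]] := unzip_padded u v.
(* The padded pair is cut where [v] ends: before the cut the second track carries letters, after it
   only padding. *)
have cat_pad : map dtail (take (size v) z) = map dsome (cw v) /\
    all (fun o => ~~ nz o) (map dtail (drop (size v) z)).
  rewrite map_take map_drop ez /pad map_cat.
  have sv : size (map (@copt A) (map Some v)) = size v by rewrite !size_map.
  rewrite take_size_cat // drop_size_cat // -!map_comp; split=> //.
  by elim: (n - size v).
exists (take (size v) z), (drop (size v) z); rewrite cat_take_drop; split.
- rewrite -(all_map dtail nz) cat_pad.1 all_map.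
  by apply/allP.
- by rewrite -(all_map dtail (fun o => ~~ nz o)) cat_pad.2.
- by apply/(dmultP muP SP); exists u, v; rewrite eu mulgVK.
- by rewrite /unpad2 cat_pad.1 /unopt; elim: (cw v) => //= x s ->.
- by rewrite unpad1_padded; apply/(gK _ Lu); rewrite eu -mulgA -invgM.
Qed.

Lemma chain_complete opts g K K' : coset_recognizer g K ->
  coset_recognizer (g * mu (opt_word opts)) K' -> (opts = [::] -> K = K') ->
  exists2 s, map dhead s = map (@copt A) opts &
    dchain (rel_ok c) rel_next K s = Cons Nil K'.
Proof.
elim: opts g K => [|a opts IH] g K gK gK' KK'.
  by exists [::] => //; rewrite KK'.
have [K1 [gK1 h]] : exists K1, coset_recognizer (g * mu (seq_of_opt a)) K1 /\
    (opts = [::] -> K1 = K').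
  case: opts gK' {IH KK'} => [|b opts] gK'.
    by exists K'; rewrite /opt_word /= cats0 in gK'.
  by have [K1 gK1] := coset_recognizer_step a gK; exists K1.
have gK2 : coset_recognizer (g * mu (seq_of_opt a) * mu (opt_word opts)) K'.
  by rewrite -mulgA -(mu_cat muP).
have [s hs hc] := IH _ _ gK1 gK2 h.
have [R RP] := rel_ok_complete gK gK1.
by exists (Cons (copt a) (Cons K1 R) :: s); rewrite /= ?hs // dchain_cons RP.
Qed.

(** For h in [H] the coset H h is [H] again, so [N] recognizes the last coset and the chain can be
    closed at [N]. *)
Lemma chain_cert_complete N opts : coset_recognizer 1 N -> is_subgroup H ->
  H (mu (opt_word opts)) ->
  exists ch, chain_cert c N (ld (map (@copt A) opts)) ch.
Proof.
move=> N1 [_ HM HV] Hopt.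
have N1' : coset_recognizer (1 * mu (opt_word opts)) N.
  move=> v Lv; rewrite mul1g (N1 v Lv) invg1 mulg1; split=> Hv.
    by apply: (HM) Hv _; apply: HV.
  by rewrite -(mulgVK (mu (opt_word opts)) (mu v)); apply: HM.
have [s hs hc] := chain_complete N1 N1' (fun _ => erefl).
by exists (ld s); rewrite /chain_cert ldK hs hc !eqxx.
Qed.
End Completeness.

Section Walks.
Variables (A : finType) (Gamma : rooted_graph A).

Lemma walk_cat p u v q : walk Gamma p (u ++ v) q <->
  exists2 r, walk Gamma p u r & walk Gamma r v q.
Proof.
elim: u p => [|x u IH] p /=; first by split=> [h|[r -> //]]; exists p.
split=> [[r pr /IH [s rs sq]]|[s [r pr rs] sq]].
  by exists s => //; exists r.
by exists r => //; apply/IH; exists s.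
Qed.

Lemma walk_inv p w q : walk Gamma p w q -> walk Gamma q (winv w) p.
Proof.
elim: w p => [|x w IH] p /=; first by move=> ->.
case=> r pr /IH h; rewrite /winv /= rev_cons -cats1; apply/walk_cat.
exists r => //=; exists p => //; move: pr; rewrite /step /=.
by case: (x) => a [].
Qed.
End Walks.

Lemma has_certs (P : data -> data -> bool) s :
  (forall w, w \in s -> exists d, P w d) ->
  exists ds, all (fun w => has (P w) ds) s.
Proof.
elim: s => [|w s IH] h; first by exists [::].
have [d Pd] := h w (mem_head _ _).
have [|ds dsP] := IH; first by move=> v vs; apply: h; rewrite inE vs orbT.
exists (d :: ds); rewrite /= Pd /=; apply: sub_all dsP => v /= ->.
by rewrite orbT.
Qed.

Lemma recognizer_cert_complete (A : finType) (G : groupType) (mu : word A -> G)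
  (L : word A -> Prop) (S : automata A) hs Gamma :
  respecting_epimorphism mu -> automatic_structure mu L S ->
  stallings_like mu L (generated mu hs) Gamma ->
  exists d, recognizer_cert (Cons (code_automata S) (code_words hs)) d.
Proof.
move=> muP SP GP; set c := code_automata S.
pose N := graph_nfa (code_rooted_graph Gamma).
have NP := stallings_recognizes GP; have [[[bG eG] con _ _] loops _] := GP.
have sH := generated_subgroup mu hs.
(* A vertex is labeled by the word of some walk from the base. The words to be certified then label
   loops at the base, and loops represent elements of the subgroup. *)
pose g p : word A := epsilon (inhabits [::]) (fun w => walk Gamma (base Gamma) w p).
have gP p : p \in vertices Gamma -> walk Gamma (base Gamma) (g p) p.
  move=> pG; apply: (epsilon_spec (inhabits [::]) (fun w => walk Gamma (base Gamma) w p)).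
  exact: con.
pose lam := ld [seq Cons (code_nat p) (ld (cw (g p))) | p <- vertices Gamma].
have lamP p : p \in vertices Gamma -> dlabel lam (code_nat p) = cw (g p).
  move=> pG; rewrite /dlabel /lam ldK.
  by rewrite (@dlookup_map _ code_nat (fun p => ld (cw (g p))) _ _ code_nat_inj) // ldK.
have [certs certsP] : exists ds, all (fun w =>
    has (member_cert c (code_words hs) (dl w)) ds) (to_certify N lam).
  apply: (has_certs (P := fun w d => member_cert c (code_words hs) (dl w) d)) => s.
  suff: s \in to_certify N lam -> exists2 w : word A, s = ld (cw w) & generated mu hs (mu w).
    by move=> h /h [w -> Hw]; rewrite ldK; apply: (member_cert_complete muP SP).
  rewrite mem_cat => /orP [|] /mapP [t tN ->].
    exists (g (base Gamma)); last by apply: loops; apply: gP.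
    have -> : t = code_nat (base Gamma).
      by move: tN; rewrite /N /dinit /dfinal /= !inE => /orP [] /eqP.
    by rewrite lamP.
  have [p [x [q [st et]]]] := (graph_trans _ _).1 tN.
  have [pG qG] : p \in vertices Gamma /\ q \in vertices Gamma.
    by move: st; rewrite /step; case: ifP => _ /eG [].
  exists (g p ++ x :: winv (g q)).
    by rewrite et /dsrc /dlab /ddst /= !lamP // -cw_inv cw_cat.
  apply: loops; apply/walk_cat; exists p; first exact: gP.
  by exists q => //; apply: walk_inv; apply: gP.
have cosetN : coset_recognizer mu L (generated mu hs) 1%g N.
  by move=> v Lv; rewrite invg1 mulg1; apply: NP.
have [chs chsP] : exists ds, all (fun h => has (chain_cert c N h) ds)
    (Cons Nil Nil :: [seq ld (map dsome (dl h)) | h <- dl (code_words hs)]).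
  apply: (has_certs (P := fun h d => chain_cert c N h d)) => h.
  rewrite inE code_wordsE ldK => /orP [/eqP ->|/mapP [_ /mapP [w whs ->] ->]].
    apply: (chain_cert_complete muP SP (opts := [:: None]) cosetN sH).
    by rewrite /= (mu_nil muP); case: sH.
  rewrite code_wordE ldK -copt_some.
  apply: (chain_cert_complete muP SP cosetN sH).
  by rewrite opt_word_some; apply: generated_mem.
have [v Lv ev] := Lrep SP 1%g.
have [dt dtP] := trivial_cert_complete muP SP ev.
exists (Cons N (Cons lam (Cons (ld certs) (Cons (ld (cw v)) (Cons dt (ld chs)))))).
rewrite /recognizer_cert /sound_cert [dhead _]/= [dtail _]/= !ldK.
apply/and5P; split=> //; first exact/(Lcw SP).
by apply/NP => //; rewrite ev; case: sH.
Qed.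

(** The program that computes Stallings-like graphs depends on the group and is not run: it shows
    that a graph, hence a certificate, exists. Conversely a certificate found gives a recognizer,
    and [quasi_convex_clock] applies. *)
Lemma automatic_recognizers : exists p, forall (A : finType) (G : groupType)
    (mu : word A -> G) (L : word A -> Prop) (S : automata A),
  respecting_epimorphism mu -> automatic_structure mu L S ->
  stallings_computable mu L ->
  solves p (with_input (code_automata S) (recognizer_problem mu L)).
Proof.
have [p pP] := search cb_recognizer_cert.
exists (PSeq p PHead) => A G mu L S muP SP [q qP].
have snd := recognizer_cert_sound muP SP.
apply: solvesI => hs /= vhs; have [h1 h2] := pP (Cons (code_automata S) (code_words hs)).
  case/(proj1 (qP hs vhs)) => Gamma [GP _].
  have [d dP e] := h1 (recognizer_cert_complete muP SP (GP : stallings_like mu L _ Gamma)).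
  exists (dhead d); first exact: snd dP.
  by apply: EvSeq e _; case: (d); constructor.
case=> y /eval_seq [d e _]; have [|d' d'P] := h2; first by exists d.
exists (size (clock (dhead (code_automata S)) (dhead d'))).
apply: (quasi_convex_clock muP (@alphabetP A)); first exact: (Lcw SP).
exact: snd d'P.
Qed.

(** * The uniform case and the theorem *)

Lemma automatic_oracles : exists rep stal aut, forall (A : finType)
    (G : groupType) (mu : word A -> G) (L : word A -> Prop) (S : automata A),
  algorithmic_structure mu L -> automatic_structure mu L S ->
  oracles mu L (code_automata S) rep stal aut.
Proof.
have [rep repP] := automatic_representatives.
have [stal stalP] := automatic_recognizers.
(* The alphabet is read off the keys of the table of multipliers, the key [None] being dropped. *)
have [aut autP] : cd (fun c => Cons (ld (unopt (map dhead (dl (dtail c))))) (dhead c)).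
  by computable.
exists rep, stal, aut => A G mu L S [muP _ _ sC] SP; split=> //.
- by move=> u _; apply: repP.
- exact: stalP.
exists (unopt (map dhead (dl (dtail (code_automata S))))), (dhead (code_automata S)).
split; [exact: autP | | exact: (Lcw SP)].
rewrite /= dl_code_seq -map_comp => d; rewrite /unopt; split.
  case/mapP=> o; rewrite mem_filter => /andP [onz /mapP [a _ eo]] ->.
  by move: onz; rewrite eo; case: a {eo} => // x _; exists x.
case=> x ->; apply/mapP; exists (copt (Some x)) => //.
by rewrite mem_filter; apply/mapP; exists (Some x); rewrite // mem_enum.
Qed.

Lemma uniform_structure P : oracle_solvable P -> uniformly_solvable P.
Proof.
move=> oP; have [rep [stal [aut O]]] := automatic_oracles.
have [p pP] := oP rep stal aut; exists p => A G mu L S _ aL SP.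
by apply: pP; apply: O.
Qed.

Theorem proposition6p1 :
  (forall (A : finType) (G : groupType) (mu : word A -> G)
     (L : word A -> Prop),
     1 < #|A| -> algorithmic_structure mu L ->
     [/\ solvable (membership_problem mu L),
         solvable (containment_problem mu L),
         solvable (equality_problem mu L)
       & solvable (least_constant_problem mu L)])
  /\
  [/\ uniformly_solvable membership_problem,
      uniformly_solvable containment_problem,
      uniformly_solvable equality_problem
    & uniformly_solvable least_constant_problem].
Proof.
split=> [A G mu L _ aL|].
  split; apply: fixed_structure aL.
  - exact: oracle_membership.
  - exact: oracle_containment.
  - exact: oracle_equality.
  - exact: oracle_least_constant.
split; apply: uniform_structure.
- exact: oracle_membership.
- exact: oracle_containment.
- exact: oracle_equality.
- exact: oracle_least_constant.
Qed.
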